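(* Let $G$ be a discrete group endowed with a length function $\ell:G\to\mathbb{R}_+$. Then the following conditions are equivalent: (1) There are constants $C$ and $D$ such that for every integer $R\geq 1$ and every $f\in\mathbb{C}G$ supported on $B_R$, $$\|f\|_*\leq C R^D\|f\|_2 .$$ (2) $H^\infty_\ell(G)\subseteq C^*_r(G)$. (3) There are constants $c,s\geq 0$ such that for every $f\in\mathbb{C}G$, $$\|f\|_*\leq c\,\|f\|_{\ell,s}.$$ (4) There are constants $C$ and $D$ such that for every integer $R\geq 1$ and all $f,g\in\mathbb{C}G$ with $f$ supported on $B_R$, $$\|f*g\|_2\leq C R^D\|f\|_2\|g\|_2 .$$ (5) There are constants $C$ and $D$ such that for every integer $R\geq 1$ and all $f,g,h\in\mathbb{C}G$ with $f$ supported on $B_R$, $$|f*g*h(e)|\leq C R^D\|f\|_2\|g\|_2\|h\|_2 .$$ (6) There are constants $M$ and $k\geq 0$ such that for all $\xi,\eta\in\ell^2(G)$ of norm one, $$\sum_{\gamma\in G}\frac{|\langle\gamma(\xi),\eta\rangle|^2}{(1+\ell(\gamma))^{2k}}\leq M .$$ (7) There are constants $C$ and $D$ such that for every integer $R\geq 1$ and all $\xi,\eta\in\ell^2(G)$ of norm one, $$\sum_{\gamma\in B_R}|\langle\gamma(\xi),\eta\rangle|^2\leq C R^{2D}.$$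
   Context: A length function on a discrete group $G$ is a function $\ell:G\to\mathbb{R}_+=[0,\infty)$ such that $\ell(\gamma)=\ell(\gamma^{-1})$ and $\ell(\gamma\mu)\leq\ell(\gamma)+\ell(\mu)$ for all $\gamma,\mu\in G$, and $\ell(e)=0$, where $e$ is the identity of $G$. For $R\geq 0$, $B_R=\{\gamma\in G:\ell(\gamma)\leq R\}$. $\mathbb{C}G$ is the complex group algebra, viewed as the algebra of finitely supported functions $f:G\to\mathbb{C}$ with convolution $f*g(\gamma)=\sum_{\mu\in G}f(\mu)g(\mu^{-1}\gamma)$; $\delta_\gamma$ denotes the function equal to $1$ at $\gamma$ and $0$ elsewhere. The Hilbert space $\ell^2(G)$ has inner product $\langle\xi,\eta\rangle=\sum_{\gamma\in G}\xi(\gamma)\overline{\eta(\gamma)}$ and norm $\|\cdot\|_2$. The left regular representation is $\gamma(\xi)=\delta_\gamma*\xi$, that is $\gamma(\xi)(g)=\xi(\gamma^{-1}g)$, for $\gamma\in G$ and $\xi\in\ell^2(G)$. Extended linearly, $f\in\mathbb{C}G$ acts on $\ell^2(G)$ by $\xi\mapsto f*\xi$, and its operator norm is $\|f\|_*=\sup\{\|f*\xi\|_2:\xi\in\ell^2(G),\ \|\xi\|_2=1\}$. The reduced C*-algebra $C^*_r(G)$ is the closure of $\mathbb{C}G$ for the operator norm in the algebra of bounded operators on $\ell^2(G)$. It is regarded as a subset of $\ell^2(G)$ via the injective map $T\mapsto T(\delta_e)$ (which sends $f\in\mathbb{C}G$ to $f$). For $s\geq 0$ and $f\in\mathbb{C}G$,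 set $\|f\|_{\ell,s}=\sqrt{\sum_{\gamma\in G}|f(\gamma)|^2(1+\ell(\gamma))^{2s}}$. $H^s_\ell(G)$ is the completion of $\mathbb{C}G$ for this norm, i.e. the space of functions $f:G\to\mathbb{C}$ with $\sum_{\gamma\in G}|f(\gamma)|^2(1+\ell(\gamma))^{2s}<\infty$, and $H^\infty_\ell(G)=\bigcap_{s\geq 0}H^s_\ell(G)\subseteq\ell^2(G)$. The inclusion in (2) is an inclusion of subsets of $\ell^2(G)$. All constants are real numbers, and may differ from one condition to another. *)

(* Defs.v *)
From HB Require Import structures.
From mathcomp Require Import all_boot all_order all_algebra.
From mathcomp Require Import complex.
From mathcomp Require Import all_classical all_reals all_analysis.
From mathcomp Require Import summability.

Set Implicit Arguments.
Unset Strict Implicit.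
Unset Printing Implicit Defensive.

Import Order.TTheory GRing.Theory Num.Theory.
Import numFieldNormedType.Exports.

Local Open Scope classical_set_scope.
Local Open Scope ring_scope.

Section LengthFunctions.
Context {R : realType} {G : groupType}.

Record length_function (l : G -> R) : Prop := LengthFunction {
  length_ge0 : forall a, 0 <= l a;
  lengthV : forall a, l a^-1%g = l a;
  lengthM : forall a b, l (a * b)%g <= l a + l b;
  length1 : l 1%g = 0 }.

Definition length_ball (l : G -> R) (r : R) : set G := [set a | l a <= r].

End LengthFunctions.

Section GroupAlgebra.
Context {R : realType} {G : groupType}.
Implicit Types (f g xi eta : G -> R[i]) (a : G).

(* The modulus as an element of R (the generic norm of R[i] is valued
   in R[i]). *)
Definition modulus (z : R[i]) : R := Normc.normc z.

Definition supp f : set G := [set a | f a != 0].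

Definition group_algebra : set (G -> R[i]) := [set f | finite_set (supp f)].

Definition delta a : G -> R[i] := fun b => (b == a)%:R.

(* A finitely supported sum, meaningful only when one of f, g has finite
   support: \sum_(m \in A) is 0 when infinitely many terms are nonzero. *)
Definition convol f g : G -> R[i] :=
  fun a => \sum_(m \in [set: G]) f m * g (m^-1 * a)%g.

Definition lreg a xi : G -> R[i] := fun b => xi (a^-1 * b)%g.

Lemma convol_delta a xi : convol (delta a) xi = lreg a xi.
Proof.
apply/funext => b; rewrite /convol /lreg /delta.
rewrite -(fsbig_widen [set a]) ?fsbig_set1 ?eqxx ?mul1r//.
by move=> m [_ /= /eqP/negbTE ->]; rewrite mul0r.
Qed.

(* Norms take values in \bar R, so that no junk value is attached to
   functions or operators with infinite norm. *)
Definition l2sum xi : \bar R :=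
  (\esum_(a in [set: G]) (modulus (xi a) ^+ 2)%:E)%E.

Definition ell2 : set (G -> R[i]) := [set xi | (l2sum xi < +oo)%E].

Definition l2norm xi : \bar R := sqrte (l2sum xi).

(* Unordered sum: limit in R[i] of the partial sums over finite subsets
   of G. *)
Definition inner xi eta : R[i] :=
  sum (fun a => (xi a * (eta a)^*%C : R[i]^o)).

Definition opnorm (T : (G -> R[i]) -> (G -> R[i])) : \bar R :=
  ereal_sup [set l2norm (T xi) | xi in [set xi | ell2 xi /\ l2norm xi = 1%E]].

(* Bounded operators on ell2 are represented by maps on all functions;
   only their values on ell2 are meaningful. *)
Record bounded_operator (T : (G -> R[i]) -> (G -> R[i])) : Prop :=
  BoundedOperator {
    bounded_operator_ell2 : forall xi, ell2 xi -> ell2 (T xi);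
    bounded_operatorP : forall (z : R[i]) xi eta, ell2 xi -> ell2 eta ->
      T (fun a => z * xi a + eta a) = (fun a => z * T xi a + T eta a);
    bounded_operator_opnorm : (opnorm T < +oo)%E }.

Definition reduced_cstar_operator (T : (G -> R[i]) -> (G -> R[i])) : Prop :=
  bounded_operator T /\
  forall e : R, 0 < e -> exists2 f, group_algebra f &
    (opnorm (fun xi a => T xi a - convol f xi a)%R < e%:E)%E.

(* The reduced C*-algebra as a subset of ell2, through T |-> T (delta 1). *)
Definition reduced_cstar : set (G -> R[i]) :=
  [set T (delta 1%g) | T in reduced_cstar_operator].

Definition sobolev_sum (l : G -> R) (s : R) f : \bar R :=
  (\esum_(a in [set: G])
     (modulus (f a) ^+ 2 * (1 + l a) `^ (2 * s))%:E)%E.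

Definition sobolev_norm (l : G -> R) (s : R) f : \bar R :=
  sqrte (sobolev_sum l s f).

Definition sobolev (l : G -> R) (s : R) : set (G -> R[i]) :=
  [set f | (sobolev_sum l s f < +oo)%E].

Definition sobolev_infty (l : G -> R) : set (G -> R[i]) :=
  \bigcap_(s in [set s : R | 0 <= s]) sobolev l s.

End GroupAlgebra.

Arguments group_algebra {R G}.
Arguments ell2 {R G}.
Arguments reduced_cstar {R G}.

(* Main.v *)
Require Import Defs.
From mathcomp Require Import all_boot all_order all_algebra.
From mathcomp Require Import finmap complex.
From mathcomp Require summability.
From mathcomp Require Import all_classical all_reals all_analysis.
From mathcomp Require Import ring lra.

Set Implicit Arguments.
Unset Strict Implicit.
Unset Printing Implicit Defensive.

Import Order.TTheory GRing.Theory Num.Theory.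
Import numFieldNormedType.Exports.

Local Open Scope classical_set_scope.
Local Open Scope ring_scope.

(** All seven conditions say the same thing about nonnegative functions.  For
    u, v, w >= 0 on G let triform u v w be the sum over a and b of
    u(a) v(a^-1 b) w(b), that is, the pairing of u * v with w.  The condition
    through which everything passes, triform_bounded, is that for some c and s
    this form is at most c times the Sobolev norm of order s of u times the
    l^2 norms of v and w.

    From the form to the conditions: pointwise, |f * xi| is at most
    |f| * |xi|, and the coefficient at a of xi and eta is at most the sum of
    |xi|(a^-1 b) |eta|(b).  The form bounds the pairing of these majorants with
    any nonnegative test function, so nrm_dual bounds their norms; this gives
    the operator norm estimates (triform_bounded_convol) and the weighted
    square summability of coefficients (triform_bounded_coeff).

    From the conditions to the form: for nonnegative functions the pointwise
    inequalities are equalities, so each of these estimates bounds the form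
    when u is supported in a ball of radius n, by a constant times a power of n
    times the l^2 norms (convol3_ball, coeff_triform_ball).  Cutting u along
    the shells j <= l < j + 1 turns this into the Sobolev bound: on such a
    shell 1 + l >= j + 1, so a Sobolev order exceeding the growth exponent by 2
    leaves the convergent series of the (j + 1)^-2 (triform_bounded_finite).

    The inclusion of the rapidly decreasing functions in the reduced algebra is
    qualitative, and deducing a bound from it is usually a matter for the
    closed graph theorem.  Positivity gives an explicit argument instead.  If
    the form were unbounded there would be u_k >= 0 of Sobolev norm of order k
    at most 2^-k, with convolution by u_k of norm above 2^k
    (triform_unbounded_witness).  The square root of the sum of the u_k^2 is
    rapidly decreasing and dominates every u_k (rapid_dominant).  An operator T
    of the reduced algebra with this value at delta_1 is convolution by it on
    finitely supported functions, so its norm exceeds every 2^k (reduced_ball).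
    Conversely, a rapidly decreasing xi acts by convolution, with absolutely
    convergent sums, and the bound applied to the difference of xi and its
    truncations shows that the truncations converge to this operator in norm
    (sobolev_infty_reduced). *)

(** * Square summable families *)

Section SquareSummable.
Context {R : realType} {I : choiceType}.
Implicit Types (u v w z : I -> R) (X : set I).

Lemma esum_fin_le u (y : \bar R) :
  (forall X, finite_set X -> (\sum_(a <- fset_set X) u a)%:E <= y)%E ->
  (\esum_(a in [set: I]) (u a)%:E <= y)%E.
Proof.
move=> h; apply: ge_ereal_sup => _ [X [finX _] <-].
by rewrite fsbig_finite// sumEFin; exact: h.
Qed.

Lemma fin_le_esum u X : finite_set X ->
  ((\sum_(a <- fset_set X) u a)%:E <= \esum_(a in [set: I]) (u a)%:E)%E.
Proof.
by move=> finX; apply: esum_ge; exists X => //; rewrite fsbig_finite// sumEFin.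
Qed.

Lemma out_support u a : ~ [set b | u b != 0] a -> u a = 0.
Proof. by move=> /negP/negPn/eqP. Qed.

Lemma esum_finite_support u X : finite_set X -> (forall a, 0 <= u a) ->
  (forall a, ~ X a -> u a = 0) ->
  \esum_(a in [set: I]) (u a)%:E = (\sum_(a <- fset_set X) u a)%:E.
Proof.
move=> finX u0 uX; rewrite -sumEFin -fsbig_finite//.
rewrite -esum_fset//; last by move=> a _; rewrite lee_fin.
rewrite [RHS]esum_mkcond; apply: eq_esum => a _.
by case: ifPn => // /negP; rewrite inE => /uX ->.
Qed.

Lemma esumZl (c : R) (a : I -> \bar R) : 0 <= c -> (forall i, 0 <= a i)%E ->
  \esum_(i in [set: I]) (c%:E * a i)%E = (c%:E * \esum_(i in [set: I]) a i)%E.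
Proof.
move=> c0 a0; rewrite /esum -ereal_supZl//; last first.
  by apply/set0P; exists 0%E, set0; [split|rewrite fsbig_set0].
congr ereal_sup; rewrite image_comp; apply: eq_imagel => X [finX _] /=.
by rewrite !fsbig_finite//= ge0_sume_distrr.
Qed.

Lemma le_esum_mul w z (e : I -> \bar R) : (forall a, 0 <= w a) ->
  (forall a, (z a)%:E <= e a)%E ->
  (\esum_(a in [set: I]) (w a * z a)%:E <=
   \esum_(a in [set: I]) ((w a)%:E * e a)%E)%E.
Proof.
move=> w0 ze; apply: le_esum => a _.
by rewrite EFinM; apply: lee_wpmul2l; rewrite ?lee_fin.
Qed.

(** Extended-real valued, like the norms of complex functions: the norm of
    xi : G -> R[i] is by definition the nrm of its modulus. *)
Definition nrm u : \bar R := sqrte (\esum_(a in [set: I]) (u a ^+ 2)%:E).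

Definition cut X u : I -> R := fun a => if a \in X then u a else 0.

Lemma cut_ge0 X u : (forall a, 0 <= u a) -> forall a, 0 <= cut X u a.
Proof. by move=> u0 a; rewrite /cut; case: ifP. Qed.

Lemma cut_le X u : (forall a, 0 <= u a) -> forall a, cut X u a <= u a.
Proof. by move=> u0 a; rewrite /cut; case: ifP. Qed.

Lemma cut_out X u a : ~ X a -> cut X u a = 0.
Proof. by move=> Xa; rewrite /cut memNset. Qed.

Lemma finite_cut X u : finite_set X -> finite_set [set a | cut X u a != 0].
Proof.
move=> finX; apply: sub_finite_set finX => a /=.
by rewrite /cut; case: ifPn => [|_]; rewrite ?inE ?eqxx.
Qed.

Lemma sqr_esum_ge0 u : (0 <= \esum_(a in [set: I]) (u a ^+ 2)%:E)%E.
Proof. by apply: esum_ge0 => a _; rewrite lee_fin sqr_ge0. Qed.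

Lemma nrm_ge0 u : (0 <= nrm u)%E.
Proof. exact: sqrte_ge0. Qed.

Lemma nrm_sqr u : (nrm u ^+ 2 = \esum_(a in [set: I]) (u a ^+ 2)%:E)%E.
Proof. exact: sqr_sqrte (sqr_esum_ge0 u). Qed.

Lemma le_nrm u v : (forall a, 0 <= u a <= v a) -> (nrm u <= nrm v)%E.
Proof.
move=> uv; rewrite lee_sqrt ?sqr_esum_ge0//; apply: le_esum => a _.
by have /andP[u0 uva] := uv a; rewrite lee_fin lerXn2r// nnegrE ?(le_trans u0).
Qed.

Lemma eq_nrm u v : u =1 v -> nrm u = nrm v.
Proof. by move=> uv; congr nrm; exact/funext. Qed.

Lemma nrmZ (c : R) u : 0 <= c -> nrm (fun a => c * u a) = (c%:E * nrm u)%E.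
Proof.
move=> c0; rewrite /nrm (_ : \esum_(a in _) _ =
    ((c ^+ 2)%:E * \esum_(a in [set: I]) (u a ^+ 2)%:E)%E); last first.
  rewrite -esumZl ?sqr_ge0//; last by move=> a; rewrite lee_fin sqr_ge0.
  by apply: eq_esum => a _; rewrite exprMn EFinM.
by rewrite sqrteM ?lee_fin ?sqr_ge0//= sqrtr_sqr ger0_norm.
Qed.

Lemma nrm_finite_support u X : finite_set X -> (forall a, ~ X a -> u a = 0) ->
  nrm u = (Num.sqrt (\sum_(a <- fset_set X) u a ^+ 2))%:E.
Proof.
move=> finX uX; rewrite /nrm (esum_finite_support finX)//.
  by move=> a; exact: sqr_ge0.
by move=> a /uX ->; rewrite expr0n.
Qed.

Lemma nrm_lty u : finite_set [set a | u a != 0] -> (nrm u < +oo)%E.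
Proof.
move=> fu; rewrite (nrm_finite_support fu) ?ltry// => a.
exact: out_support.
Qed.

Lemma le_coord_nrm u a : 0 <= u a -> ((u a)%:E <= nrm u)%E.
Proof.
move=> u0; have -> : (u a)%:E = sqrte (u a ^+ 2)%:E.
  by rewrite /= sqrtr_sqr ger0_norm.
rewrite lee_sqrt ?sqr_esum_ge0//.
have := @fin_le_esum (fun a => u a ^+ 2) [set a] (finite_set1 a).
by rewrite fset_set1 big_seq_fset1.
Qed.

Lemma nrm_eq0 u : (forall a, 0 <= u a) -> nrm u = 0%E -> forall a, u a = 0.
Proof.
move=> u0 nu a; apply/eqP; rewrite eq_le u0 andbT.
by have := le_coord_nrm (u0 a); rewrite nu lee_fin.
Qed.

Lemma sum_cauchy_schwarz (r : seq I) u v :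
  (\sum_(a <- r) u a * v a) ^+ 2 <=
  (\sum_(a <- r) u a ^+ 2) * (\sum_(a <- r) v a ^+ 2).
Proof.
elim: r => [|a r IH]; first by rewrite !big_nil expr0n mul0r.
rewrite !big_cons; set A := \sum_(i <- r) u i ^+ 2 in IH *.
set C := \sum_(i <- r) v i ^+ 2 in IH *; set B := \sum_(i <- r) _ in IH *.
have A0 : 0 <= A by apply: sumr_ge0 => i _; exact: sqr_ge0.
have C0 : 0 <= C by apply: sumr_ge0 => i _; exact: sqr_ge0.
(* From B^2 <= A C, the cross term is bounded by the arithmetic-geometric
   mean inequality. *)
suff h : 2 * B * (u a * v a) <= A * v a ^+ 2 + C * u a ^+ 2 by nra.
have D0 : 0 <= A * v a ^+ 2 + C * u a ^+ 2.
  by rewrite addr_ge0// mulr_ge0// sqr_ge0.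
have [h|h] := leP (2 * B * (u a * v a)) 0; first exact: le_trans h D0.
rewrite -ler_sqr ?nnegrE ?(ltW h)//.
have : B ^+ 2 * (u a * v a) ^+ 2 <= A * C * (u a * v a) ^+ 2.
  by rewrite ler_wpM2r// sqr_ge0.
have := sqr_ge0 (A * v a ^+ 2 - C * u a ^+ 2).
nra.
Qed.

(** When one norm is infinite and the other is 0, the product is 0, and so is
    one of the two functions. *)
Lemma cauchy_schwarz u v : (forall a, 0 <= u a) -> (forall a, 0 <= v a) ->
  (\esum_(a in [set: I]) (u a * v a)%:E <= nrm u * nrm v)%E.
Proof.
move=> u0 v0; apply: esum_fin_le => X finX.
have := sum_cauchy_schwarz (fset_set X) u v.
set A := \sum_(i <- _) u i ^+ 2; set C := \sum_(i <- _) v i ^+ 2.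
have A0 : 0 <= A by apply: sumr_ge0 => i _; exact: sqr_ge0.
have C0 : 0 <= C by apply: sumr_ge0 => i _; exact: sqr_ge0.
move=> cs; apply: (@le_trans _ _ (sqrte A%:E * sqrte C%:E)%E).
  rewrite /= -EFinM lee_fin -ler_sqr ?nnegrE.
  - by rewrite exprMn !sqr_sqrtr.
  - by apply: sumr_ge0 => i _; exact: mulr_ge0.
  - by rewrite mulr_ge0// sqrtr_ge0.
apply: lee_pmul; rewrite ?sqrte_ge0// lee_sqrt ?sqr_esum_ge0//;
  exact: fin_le_esum.
Qed.

(** Testing against the restriction of z to a finite set X bounds the square
    of its norm by K times its norm, hence its norm by K.  In the applications
    the pairings with z are values of a trilinear form. *)
Lemma nrm_dual z (K : R) : 0 <= K -> (forall a, 0 <= z a) ->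
  (forall w, (forall a, 0 <= w a) -> finite_set [set a | w a != 0] ->
    (\esum_(a in [set: I]) (w a * z a)%:E <= K%:E * nrm w)%E) ->
  (nrm z <= K%:E)%E.
Proof.
move=> K0 z0 h; rewrite /nrm.
have -> : K%:E = sqrte (K ^+ 2)%:E by rewrite /= sqrtr_sqr ger0_norm.
rewrite lee_sqrt ?lee_fin ?sqr_ge0//; apply: esum_fin_le => X finX.
have := h (cut X z) (cut_ge0 X z0) (finite_cut z finX).
rewrite (esum_finite_support finX); last 2 first.
- by move=> a; rewrite mulr_ge0// cut_ge0.
- by move=> a /cut_out ->; rewrite mul0r.
rewrite (nrm_finite_support finX); last by move=> a /cut_out.
have E a : a \in fset_set X -> cut X z a = z a.
  by rewrite in_fset_set// /cut => ->.
under eq_big_seq => a aX do rewrite E// -expr2.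
under [X in Num.sqrt X]eq_big_seq => a aX do rewrite E//.
set A := \sum_(i <- _) _; rewrite -EFinM !lee_fin.
have A0 : 0 <= A by apply: sumr_ge0 => i _; exact: sqr_ge0.
rewrite -{1}(sqr_sqrtr A0) expr2 => AK.
have [sA|sA] := leP (Num.sqrt A) 0.
  rewrite -(sqr_sqrtr A0) (_ : Num.sqrt A = 0) ?expr0n ?sqr_ge0//.
  by apply/eqP; rewrite eq_le sA sqrtr_ge0.
rewrite ler_pM2r// in AK.
by rewrite -(sqr_sqrtr A0) lerXn2r// nnegrE sqrtr_ge0.
Qed.

(** Used with a weighted function, this says that truncations converge in
    Sobolev norm. *)
Lemma nrm_tail u (e : R) :
  (nrm u < +oo)%E -> 0 < e ->
  exists2 X, finite_set X & (nrm (cut (~` X) u) <= e%:E)%E.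
Proof.
move=> un e0; set E := \esum_(a in [set: I]) (u a ^+ 2)%:E.
have fE : E \is a fin_num.
  rewrite -sqrte_fin_num ?sqr_esum_ge0// ge0_fin_numE//; exact: sqrte_ge0.
have /ub_ereal_sup_adherent := fE.
have e2 : 0 < e ^+ 2 by rewrite exprn_gt0.
move=> /(_ _ e2) [_ [X [finX _] <-] hX]; exists X => //.
rewrite (_ : e%:E = sqrte (e ^+ 2)%:E); last first.
  by rewrite /= sqrtr_sqr gtr0_norm.
rewrite lee_sqrt ?lee_fin ?sqr_ge0//.
have EX : E = (\esum_(a in [set: I]) (cut X u a ^+ 2)%:E +
    \esum_(a in [set: I]) (cut (~` X) u a ^+ 2)%:E)%E.
  rewrite -esumD => [|a _|a _]; rewrite ?lee_fin ?sqr_ge0//.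
  apply: eq_esum => a _; rewrite -EFinD; congr EFin; rewrite /cut in_setC.
  by case: (a \in X) => /=; rewrite expr0n/= ?addr0 ?add0r.
have EX2 : \esum_(a in [set: I]) (cut X u a ^+ 2)%:E =
    (\sum_(a \in X) (u a ^+ 2)%:E)%E.
  rewrite -esum_fset//; last by move=> a _; rewrite lee_fin sqr_ge0.
  rewrite [RHS]esum_mkcond; apply: eq_esum => a _; rewrite /cut.
  by case: ifP; rewrite ?expr0n.
have f1 : (\sum_(a \in X) (u a ^+ 2)%:E)%E \is a fin_num.
  by rewrite fsbig_finite// sumEFin.
rewrite -(leeD2lE _ _ f1) -EX2 -EX EX2.
by move: hX; rewrite -/E lteBlDr// => /ltW.
Qed.

End SquareSummable.

Lemma nrm_reindex (R : realType) (I J : choiceType) (e : I -> J) (u : J -> R) :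
  set_bij [set: I] [set: J] e -> nrm (u \o e) = nrm u.
Proof. by move=> be; rewrite /nrm (reindex_esum _ _ _ _ be). Qed.

Lemma esum_swap (R : realType) (I J : choiceType) (a : I -> J -> \bar R) :
  (forall i j, 0 <= a i j)%E ->
  \esum_(i in [set: I]) \esum_(j in [set: J]) a i j =
  \esum_(j in [set: J]) \esum_(i in [set: I]) a i j.
Proof.
move=> a0; rewrite (esum_esum (J := fun=> setT))//.
rewrite [RHS](esum_esum (J := fun=> setT) (a := fun j i => a i j))//.
have [-> ->] : [set: I] `*`` (fun=> [set: J]) = [set: I * J] /\
    [set: J] `*`` (fun=> [set: I]) = [set: J * I].
  by split; apply/seteqP; split.
rewrite (reindex_esum [set: J * I] [set: I * J] (fun p => (p.2, p.1)))//.
by split=> // [[i j] [i' j'] _ _ /= [-> ->]//|[i j] _]; exists (j, i).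
Qed.

(** * The convolution form on nonnegative functions *)

Section ConvolutionForm.
Context {R : realType} {G : groupType}.
Implicit Types (u v w z : G -> R) (l : G -> R).

(** The pairing of u * v with w: the pair p stands for (a, b) in
    u(a) v(a^-1 b) w(b).  All terms are meant to be nonnegative, so that the
    sum always makes sense in the extended reals and can be taken in any
    order. *)
Definition triform u v w : \bar R :=
  \esum_(p in [set: G * G]) (u p.1 * v (p.1^-1 * p.2)%g * w p.2)%:E.

Lemma mulVg_bij (b : G) : set_bij [set: G] [set: G] (fun a => (a^-1 * b)%g).
Proof.
split=> // [a a' _ _ /mulIg/invg_inj//|a _].
by exists (b * a^-1)%g => //; rewrite invgM invgK mulgVK.
Qed.

(** Summing over b first makes the coefficients of the regular representation
    appear. *)
Lemma triform_left u v w : (forall a, 0 <= u a) -> (forall a, 0 <= v a) ->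
  (forall a, 0 <= w a) ->
  triform u v w = \esum_(a in [set: G])
    ((u a)%:E * \esum_(b in [set: G]) (v (a^-1 * b)%g * w b)%:E)%E.
Proof.
move=> u0 v0 w0; transitivity (\esum_(a in [set: G]) \esum_(b in [set: G])
   (u a * v (a^-1 * b)%g * w b)%:E).
  rewrite (esum_esum (a := fun a b => (u a * v (a^-1 * b)%g * w b)%:E))//.
    by rewrite /triform; congr esum; apply/seteqP; split.
  by move=> a b _ _; rewrite lee_fin !mulr_ge0.
apply: eq_esum => a _; rewrite -esumZl//; last first.
  by move=> b; rewrite lee_fin mulr_ge0.
by apply: eq_esum => b _; rewrite -EFinM mulrA.
Qed.

(** Summing over a first makes the convolution of u and v appear. *)
Lemma triform_right u v w : (forall a, 0 <= u a) -> (forall a, 0 <= v a) ->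
  (forall a, 0 <= w a) ->
  triform u v w = \esum_(b in [set: G])
    ((w b)%:E * \esum_(a in [set: G]) (u a * v (a^-1 * b)%g)%:E)%E.
Proof.
move=> u0 v0 w0; transitivity (\esum_(b in [set: G]) \esum_(a in [set: G])
   (u a * v (a^-1 * b)%g * w b)%:E).
  rewrite esum_swap; last by move=> b a; rewrite lee_fin !mulr_ge0.
  rewrite (esum_esum (a := fun a b => (u a * v (a^-1 * b)%g * w b)%:E))//.
    by rewrite /triform; congr esum; apply/seteqP; split.
  by move=> a b _ _; rewrite lee_fin !mulr_ge0.
apply: eq_esum => b _; rewrite -esumZl//; last first.
  by move=> a; rewrite lee_fin mulr_ge0.
by apply: eq_esum => a _; rewrite -EFinM; congr EFin; rewrite mulrC.
Qed.

Lemma le_triform u u' v w : (forall a, u a <= u' a) ->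
  (forall a, 0 <= v a) -> (forall a, 0 <= w a) ->
  (triform u v w <= triform u' v w)%E.
Proof.
move=> uu' v0 w0; apply: le_esum => p _.
by rewrite lee_fin ler_wpM2r// ler_wpM2r.
Qed.

Lemma triformZ (c d e : R) u v w : 0 <= c -> 0 <= d -> 0 <= e ->
  (forall a, 0 <= u a) -> (forall a, 0 <= v a) -> (forall a, 0 <= w a) ->
  triform (fun a => c * u a) (fun a => d * v a) (fun a => e * w a) =
  ((c * d * e)%:E * triform u v w)%E.
Proof.
move=> c0 d0 e0 u0 v0 w0; rewrite /triform -esumZl ?mulr_ge0//; last first.
  by move=> p; rewrite lee_fin !mulr_ge0.
by apply: eq_esum => p _; rewrite -EFinM; congr EFin; ring.
Qed.

Lemma triformZl (c : R) u v w : 0 <= c ->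
  (forall a, 0 <= u a) -> (forall a, 0 <= v a) -> (forall a, 0 <= w a) ->
  triform (fun a => c * u a) v w = (c%:E * triform u v w)%E.
Proof.
move=> c0 u0 v0 w0; rewrite /triform -esumZl//; last first.
  by move=> p; rewrite lee_fin !mulr_ge0.
by apply: eq_esum => p _; rewrite -EFinM !mulrA.
Qed.

Lemma triform0 u v w :
  [\/ forall a, u a = 0, forall a, v a = 0 | forall a, w a = 0] ->
  triform u v w = 0%E.
Proof.
by move=> h; apply: esum1 => p _; case: h => ->; rewrite ?(mul0r, mulr0).
Qed.

(** The Sobolev norm of order s, as the norm of a weighted function. *)
Definition snrm l (s : R) u : \bar R := nrm (fun a => u a * (1 + l a) `^ s).

Lemma snrm_ge0 l (s : R) u : (0 <= snrm l s u)%E.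
Proof. exact: nrm_ge0. Qed.

Lemma snrm_lty l (s : R) u : finite_set [set a | u a != 0] ->
  (snrm l s u < +oo)%E.
Proof.
move=> fu; apply: nrm_lty; apply: sub_finite_set fu => a /=.
by apply: contraNN => /eqP ->; rewrite mul0r.
Qed.

Lemma snrmZ l (s c : R) u : 0 <= c ->
  snrm l s (fun a => c * u a) = (c%:E * snrm l s u)%E.
Proof. by move=> c0; rewrite -nrmZ//; apply: eq_nrm => a; rewrite mulrA. Qed.

Lemma le_snrm l (s t : R) u : (forall a, 0 <= l a) -> (forall a, 0 <= u a) ->
  s <= t -> (snrm l s u <= snrm l t u)%E.
Proof.
move=> l0 u0 st; apply: le_nrm => a; rewrite mulr_ge0 ?powR_ge0//=.
by rewrite ler_wpM2l// ler_powR// lerDl.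
Qed.

Lemma snrm0E l u : snrm l 0 u = nrm u.
Proof. by apply: eq_nrm => a; rewrite powRr0 mulr1. Qed.

Lemma powR1D_le (s : R) (n : nat) (x : R) : (1 <= n)%N -> 0 <= s -> 0 <= x ->
  x <= n%:R -> (1 + x) `^ s <= 2 `^ s * n%:R `^ s.
Proof.
move=> n1 s0 x0 xn; have n1' : 1 <= n%:R :> R by rewrite ler1n.
rewrite -powRM ?ler0n//; apply: ge0_ler_powR => //; rewrite ?nnegrE; lra.
Qed.

Lemma snrm_ball l (s : R) (n : nat) u : (1 <= n)%N -> 0 <= s ->
  (forall a, 0 <= l a) -> (forall a, 0 <= u a) ->
  (forall a, u a != 0 -> l a <= n%:R) ->
  (snrm l s u <= (2 `^ s * n%:R `^ s)%:E * nrm u)%E.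
Proof.
move=> n1 s0 l0 u0 ul; rewrite -nrmZ ?mulr_ge0 ?powR_ge0//.
apply: le_nrm => a; rewrite mulr_ge0 ?powR_ge0//=.
have [->|ua] := eqVneq (u a) 0; first by rewrite mul0r mulr0.
by rewrite mulrC ler_wpM2r// powR1D_le// ul.
Qed.

Definition triform_bounded l (c s : R) : Prop :=
  forall u v w, (forall a, 0 <= u a) -> (forall a, 0 <= v a) ->
    (forall a, 0 <= w a) ->
    (triform u v w <= c%:E * (snrm l s u * (nrm v * nrm w)))%E.

(** Supports are finite because conditions on the group algebra can only be
    tested on such functions. *)
Definition ball_triform_bounded l (C D : R) : Prop :=
  forall n : nat, (1 <= n)%N -> forall u v w,
    (forall a, 0 <= u a) -> (forall a, 0 <= v a) -> (forall a, 0 <= w a) ->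
    finite_set [set a | u a != 0] -> finite_set [set a | v a != 0] ->
    finite_set [set a | w a != 0] ->
    (forall a, u a != 0 -> l a <= n%:R) ->
    (triform u v w <= (C * n%:R `^ D)%:E * (nrm u * (nrm v * nrm w)))%E.

Lemma sum_inv_sqr_le2 n : \sum_(j < n) (j.+1%:R ^- 2 : R) <= 2.
Proof.
(* The increments are at most those of the telescoping sum of -1/n. *)
suff: \sum_(j < n.+1) (j.+1%:R ^- 2 : R) <= 2 - n.+1%:R^-1.
  rewrite big_ord_recr/= => h; have p : 0 < n.+1%:R :> R by rewrite ltr0n.
  apply: le_trans (_ : 2 - n.+1%:R^-1 <= 2); last by rewrite gerBl invr_ge0 ltW.
  by apply: le_trans h; rewrite lerDl invr_ge0 exprn_ge0// ltW.
elim: n => [|n IH]; first by rewrite big_ord1/= expr1n invr1; lra.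
rewrite big_ord_recr/=; set x : R := n.+1%:R in IH *.
have x0 : 0 < x by rewrite ltr0n.
rewrite (_ : n.+2%:R = x + 1 :> R); last by rewrite /x natr1.
have y0 : 0 < x + 1 by rewrite ltr_wpDr.
suff h: (x + 1) ^- 2 <= x^-1 - (x + 1)^-1.
  by apply: (le_trans (lerD IH h)); rewrite addrA subrK.
rewrite (_ : x^-1 - (x + 1)^-1 = (x * (x + 1))^-1); last first.
  by field; rewrite !gt_eqF.
by rewrite lef_pV2 ?posrE ?mulr_gt0// expr2 ler_pM2r//; lra.
Qed.

(** Cut u along the shells j <= l < j + 1.  The piece in shell j lies in the
    ball of radius j + 1, and its l^2 norm is at most (j + 1)^-(D + 2) times
    the Sobolev norm of order D + 2 of u.  Against the growth (j + 1)^D there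
    remains (j + 1)^-2, which sums to at most 2. *)
Lemma triform_bounded_finite l (C D : R) :
  (forall a, 0 <= l a) -> 0 <= C -> 0 <= D ->
  ball_triform_bounded l C D -> forall u v w,
  (forall a, 0 <= u a) -> (forall a, 0 <= v a) -> (forall a, 0 <= w a) ->
  finite_set [set a | u a != 0] -> finite_set [set a | v a != 0] ->
  finite_set [set a | w a != 0] ->
  (triform u v w <= (C * 2)%:E * (snrm l (D + 2) u * (nrm v * nrm w)))%E.
Proof.
move=> l0 C0 D0 bb u v w u0 v0 w0 fu fv fw.
pose shell j := [set a | j = Num.truncn (l a)].
(* A bound for the number of shells met by the support of u. *)
pose N := \max_(a <- fset_set [set a | u a != 0]) (Num.truncn (l a)).+1.
have shellE a : \sum_(j < N) cut (shell j) u a = u a.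
  rewrite (eq_bigr (fun j : 'I_N =>
      if (j == Num.truncn (l a) :> nat) then u a else 0)).
    rewrite -big_mkcond/= (big_ord1_eq _ (fun=> u a)); case: ifPn => //.
    move=> aN; apply/esym/eqP; move: aN; apply: contraNT => ua.
    have -> : (Num.truncn (l a) < N)%N = true.
      apply: (@leq_bigmax_seq _ _ xpredT
        (fun a => (Num.truncn (l a)).+1) a) => //.
      by rewrite in_fset_set// inE.
    by [].
  move=> j _; rewrite /cut; congr (if _ then _ else _).
  by apply/idP/eqP; rewrite inE.
have -> : triform u v w = (\sum_(j < N) triform (cut (shell j) u) v w)%E.
  rewrite /triform -esum_sum; last first.
    by move=> p j _ _; rewrite lee_fin !mulr_ge0// cut_ge0.
  apply: eq_esum => p _; rewrite sumEFin; congr EFin.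
  by rewrite -mulr_suml -mulr_suml shellE.
have X0 : (0 <= snrm l (D + 2) u * (nrm v * nrm w))%E.
  by rewrite !mule_ge0// nrm_ge0.
apply: (@le_trans _ _ (\sum_(j < N) ((C * j.+1%:R ^- 2)%:E *
    (snrm l (D + 2) u * (nrm v * nrm w))))%E); last first.
  rewrite -ge0_sume_distrl; last first.
    by move=> j _; rewrite lee_fin mulr_ge0// invr_ge0 exprn_ge0.
  rewrite sumEFin -mulr_sumr lee_wpmul2r// lee_fin ler_wpM2l//.
  exact: sum_inv_sqr_le2.
apply: lee_sum => j _; set x : R := j.+1%:R.
have x0 : 0 < x by rewrite ltr0n.
have fuj : finite_set [set a | cut (shell j) u a != 0].
  apply: sub_finite_set fu => a /=.
  by rewrite /cut; case: ifP => //; rewrite eqxx.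
have uj a : cut (shell j) u a != 0 -> x - 1 <= l a <= x.
  rewrite /cut; case: ifPn; rewrite ?eqxx// inE /shell/= => jE _.
  have /andP[h1 h2] : j%:R <= l a < j.+1%:R by rewrite jE; exact: truncn_itv.
  by rewrite /x -natr1 addrK h1/= natr1 ltW.
apply: (le_trans (bb j.+1 _ _ _ _ (cut_ge0 _ u0) v0 w0 fuj fv fw _)) => //.
  by move=> a /uj /andP[].
have : (nrm (cut (shell j) u) <= (x `^ (- (D + 2)))%:E * snrm l (D + 2) u)%E.
  rewrite -nrmZ ?powR_ge0//; apply: le_nrm => a; rewrite cut_ge0//=.
  have [->|na] := eqVneq (cut (shell j) u a) 0.
    by rewrite !mulr_ge0 ?powR_ge0.
  have /andP[h1 _] := uj _ na.
  apply: (le_trans (cut_le _ u0 _)).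
  rewrite powRN mulrCA ler_peMr// mulrC ler_pdivlMr ?powR_gt0// mul1r.
  by apply: ge0_ler_powR; rewrite ?nnegrE; lra.
move=> h; apply: (@le_trans _ _ ((C * x `^ D)%:E *
   ((x `^ (- (D + 2)))%:E * snrm l (D + 2) u * (nrm v * nrm w)))%E).
  apply: lee_wpmul2l; first by rewrite lee_fin mulr_ge0// powR_ge0.
  by rewrite lee_wpmul2r// mule_ge0// nrm_ge0.
rewrite !muleA -EFinM -!muleA -mulrA -powRD; last first.
  by apply/implyP => _; rewrite gt_eqF.
have -> : D + - (D + 2) = - 2 by ring.
by rewrite powRN (powR_mulrn 2 (ltW x0)).
Qed.

(** Each finite partial sum of the form only sees truncations of the three
    functions. *)
Lemma triform_bounded_ball l (C D : R) :
  (forall a, 0 <= l a) -> 0 <= C -> 0 <= D ->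
  ball_triform_bounded l C D -> triform_bounded l (C * 2) (D + 2).
Proof.
move=> l0 C0 D0 bb u v w u0 v0 w0; apply: esum_fin_le => X finX.
pose A := [set p.1 | p in X]; pose B := [set (p.1^-1 * p.2)%g | p in X].
pose E := [set p.2 | p in X].
have fA : finite_set A by exact: finite_image.
have fB : finite_set B by exact: finite_image.
have fE : finite_set E by exact: finite_image.
apply: (@le_trans _ _ (triform (cut A u) (cut B v) (cut E w))).
  apply: le_trans (fin_le_esum _ finX); rewrite lee_fin.
  rewrite big_seq [leRHS]big_seq; apply: ler_sum => p.
  rewrite in_fset_set// inE => Xp.
  by rewrite /cut !mem_set//; exists p.
have K0 : 0 <= C * 2 by rewrite mulr_ge0.
apply: (le_trans (triform_bounded_finite l0 C0 D0 bb
  (cut_ge0 A u0) (cut_ge0 B v0) (cut_ge0 E w0)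
  (finite_cut _ fA) (finite_cut _ fB) (finite_cut _ fE))).
apply: lee_wpmul2l; first by rewrite lee_fin.
by apply: lee_pmul; rewrite ?mule_ge0 ?nrm_ge0//;
  [|apply: lee_pmul; rewrite ?nrm_ge0//]; apply: le_nrm => a;
  rewrite ?mulr_ge0 ?cut_ge0 ?powR_ge0// ?ler_wpM2r ?powR_ge0// cut_le.
Qed.

(** By duality, the bound on the form is a bound on convolution by u; z is a
    real-valued minorant of the possibly infinite u * v. *)
Lemma triform_bounded_convol l (c s : R) u v (z : G -> R) :
  triform_bounded l c s -> 0 <= c ->
  (forall a, 0 <= u a) -> (forall a, 0 <= v a) -> (forall a, 0 <= z a) ->
  (snrm l s u < +oo)%E -> (nrm v < +oo)%E ->
  (forall b, (z b)%:E <= \esum_(a in [set: G]) (u a * v (a^-1 * b)%g)%:E)%E ->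
  (nrm z <= c%:E * (snrm l s u * nrm v))%E.
Proof.
move=> tb c0 u0 v0 z0 fu fv hz.
have Efu : snrm l s u \is a fin_num by rewrite ge0_fin_numE ?nrm_ge0.
have Efv : nrm v \is a fin_num by rewrite ge0_fin_numE ?nrm_ge0.
have K0 : (0 <= c%:E * (snrm l s u * nrm v))%E.
  by rewrite !mule_ge0 ?lee_fin ?nrm_ge0.
have EK : (c%:E * (snrm l s u * nrm v))%E \is a fin_num.
  by rewrite !fin_numM.
rewrite -(fineK EK); apply: nrm_dual => //; first by rewrite fine_ge0.
move=> w w0 _; rewrite fineK//.
apply: (le_trans (le_esum_mul w0 hz)).
by rewrite -triform_right// -!muleA; exact: tb.
Qed.

End ConvolutionForm.

(** * Complex families: moduli, finite and unordered sums *)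

Section Modulus.
Context {R : realType}.
Implicit Types (x y z : R[i]).

Lemma modulus_ge0 z : 0 <= modulus z.
Proof. by case: z => a b; rewrite sqrtr_ge0. Qed.

Lemma modulus0 : modulus (0 : R[i]) = 0.
Proof. exact: Normc.normc0. Qed.

Lemma modulusM x y : modulus (x * y) = modulus x * modulus y.
Proof. exact: Normc.normcM. Qed.

Lemma modulusD x y : modulus (x + y) <= modulus x + modulus y.
Proof. exact: le_normcD. Qed.

Lemma modulusN x : modulus (- x) = modulus x.
Proof. exact: normcN. Qed.

Lemma modulus_real (r : R) : modulus r%:C%C = `|r|.
Proof. by rewrite /modulus /= expr0n /= addr0 sqrtr_sqr. Qed.

Lemma modulus_conj x : modulus x^*%C = modulus x.
Proof. by case: x => a b; rewrite /modulus /= sqrrN. Qed.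

Lemma normC_modulus z : `|z| = (modulus z)%:C%C.
Proof. by rewrite normc_def; case: z. Qed.

Lemma modulus_big (I : Type) (r : seq I) (F : I -> R[i]) :
  modulus (\sum_(i <- r) F i) <= \sum_(i <- r) modulus (F i).
Proof.
elim: r => [|i r IH]; first by rewrite !big_nil modulus0.
by rewrite !big_cons; apply: (le_trans (modulusD _ _)); rewrite lerD2l.
Qed.

(** When the support is infinite the sum is 0 by convention, so the triangle
    inequality holds for every family. *)
Lemma modulus_fsum (I : choiceType) (F : I -> R[i]) :
  ((modulus (\sum_(i \in [set: I]) F i)%R)%:E <=
   \esum_(i in [set: I]) (modulus (F i))%:E)%E.
Proof.
have [fF|iF] := pselect (finite_set ([set: I] `&` F @^-1` [set~ 0]));
  last first.
  rewrite fsbig_dflt// modulus0.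
  by apply: esum_ge0 => i _; rewrite lee_fin modulus_ge0.
rewrite fsbig_supp fsbig_finite//.
apply: le_trans (fin_le_esum (fun i => modulus (F i)) fF).
by rewrite lee_fin modulus_big.
Qed.

Lemma fsum_finite_support (V : nmodType) (I : choiceType) (F : I -> V)
    (X : set I) : finite_set X -> (forall i, ~ X i -> F i = 0) ->
  \sum_(i \in [set: I]) F i = \sum_(i <- fset_set X) F i.
Proof.
move=> finX FX; apply: fsbigTE => i; rewrite in_fset_set// => Xi.
by apply: FX => /mem_set; apply/negP.
Qed.

(** If the unordered sum diverges, its lim is the default value 0 and there is
    nothing to prove; otherwise every partial sum satisfies the bound. *)
Lemma modulus_sum_le (I : choiceType) (F : I -> R[i]) :
  ((modulus (summability.sum (F : I -> R[i]^o)))%:E <=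
   \esum_(i in [set: I]) (modulus (F i))%:E)%E.
Proof.
have E0 : (0 <= \esum_(i in [set: I]) (modulus (F i))%:E)%E.
  by apply: esum_ge0 => i _; rewrite lee_fin modulus_ge0.
rewrite /summability.sum; set S := summability.partial_sum _.
have [cS|dS] := pselect (cvg (S @ summability.totally)); last first.
  by rewrite (dvgP dS) modulus0.
case EM : (esum _ _) => [M| |]; [|by rewrite leey|by rewrite EM in E0].
have SM A : modulus (S A) <= M.
  rewrite -lee_fin -EM.
  have -> : S A = \sum_(i <- A) F i by rewrite big_seq_fsetE.
  apply: le_trans (fin_le_esum (fun i => modulus (F i)) (finite_fset A)).
  by rewrite set_fsetK lee_fin modulus_big.
rewrite lee_fin leNgt; apply/negP => ML.
set L := lim _ in ML cS.
have e0 : 0 < (modulus L - M)%:C%C :> R[i] by rewrite ltcR subr_gt0.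
have PF := @summability.totally_filter I.
have /cvgr_dist_lt/(_ _ e0) near_L := cS.
have [A] := @filter_ex _ _ PF _ near_L.
rewrite normC_modulus ltcR ltrBrDr ltNge => /negP; apply.
apply: le_trans (lerD (lexx _) (SM A)).
by rewrite -{1}(subrK (S A) L); exact: modulusD.
Qed.

(** The partial sums are constant as soon as they contain the support. *)
Lemma sum_finite_support (I : choiceType) (F : I -> R[i]) (X : set I) :
  finite_set X -> (forall i, ~ X i -> F i = 0) ->
  summability.sum (F : I -> R[i]^o) = \sum_(i <- fset_set X) F i.
Proof.
move=> finX FX; have PF := @summability.totally_filter I.
apply: norm_lim_near_cst; exists (fset_set X) => // A /= XA.
rewrite /summability.partial_sum.
rewrite -(big_seq_fsetE _ _ xpredT (F : I -> R[i]^o))/=.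
rewrite (big_fsetID _ (mem X))/= [X in _ + X]big1_fset ?addr0; last first.
  by move=> i; rewrite !inE/= => /andP[_ /negP iX] _; apply: FX => /mem_set.
apply: eq_fbigl => i; rewrite !inE/= andbC.
by apply/andP/idP => [[iX _]|iX];
  [rewrite in_fset_set|split; [rewrite in_fset_set// in iX|]];
  last exact: (fsubsetP XA).
Qed.

End Modulus.

(** * Absolutely summable families *)

Section AbsoluteSum.
Context {R : realType} {I : choiceType}.
Implicit Types (x y p q : I -> R) (z : R[i]) (f g : I -> R[i]).

Let S p : \bar R := \esum_(i in [set: I]) (p i)%:E.

Let S_ge0 p : (forall i, 0 <= p i) -> (0 <= S p)%E.
Proof. by move=> p0; apply: esum_ge0 => i _; rewrite lee_fin. Qed.

Let SD p q : (forall i, 0 <= p i) -> (forall i, 0 <= q i) ->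
  S (fun i => p i + q i) = (S p + S q)%E.
Proof.
by move=> p0 q0; rewrite -esumD => [|i _|i _]; rewrite ?lee_fin.
Qed.

Let SZ (c : R) p : 0 <= c -> (forall i, 0 <= p i) ->
  S (fun i => c * p i) = (c%:E * S p)%E.
Proof. by move=> c0 p0; rewrite -esumZl => [|//|i]; rewrite ?lee_fin. Qed.

Let leS p q : (forall i, p i <= q i) -> (S p <= S q)%E.
Proof. by move=> pq; apply: le_esum => i _; rewrite lee_fin. Qed.

Let S_fin p : (forall i, 0 <= p i) -> (S p < +oo)%E -> S p \is a fin_num.
Proof. by move=> p0; rewrite ge0_fin_numE// S_ge0. Qed.

Definition abs_summable x : Prop :=
  (\esum_(i in [set: I]) `|x i|%:E < +oo)%E.

(** The sum of an absolutely summable family, as the difference of the sums of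
    the nonnegative families |x| + x and |x|: linearity then comes from the
    additivity of sums of nonnegative terms. *)
Definition rsum x : R :=
  fine (\esum_(i in [set: I]) (`|x i| + x i)%:E) -
  fine (\esum_(i in [set: I]) `|x i|%:E).

Let pos_ge0 x i : 0 <= `|x i| + x i.
Proof. by rewrite -lerBlDr sub0r -normrN ler_norm. Qed.

Let pos_lty x : abs_summable x -> (S (fun i => `|x i| + x i)%R < +oo)%E.
Proof.
move=> sx; apply: (@le_lt_trans _ _ (S (fun i => `|x i| + `|x i|))).
  by apply: leS => i; rewrite lerD2l ler_norm.
by rewrite SD// lte_add_pinfty.
Qed.

(** Any decomposition as a difference of nonnegative summable families gives
    the same value: p + |x| = q + (|x| + x). *)
Lemma rsumE x p q : (forall i, 0 <= p i) -> (forall i, 0 <= q i) ->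
  (S p < +oo)%E -> (S q < +oo)%E -> (forall i, x i = p i - q i) ->
  rsum x = fine (S p) - fine (S q).
Proof.
move=> p0 q0 sp sq xpq.
have sx : abs_summable x.
  apply: (@le_lt_trans _ _ (S (fun i => p i + q i))).
    by apply: leS => i; rewrite xpq (le_trans (ler_normB _ _))// !ger0_norm.
  by rewrite SD// lte_add_pinfty.
have E : (S (fun i => `|x i| + x i)%R + S q = S p + S (fun i => `|x i|)%R)%E.
  rewrite -!SD//; congr esum; apply/funext => i; congr EFin.
  by rewrite xpq; ring.
have /(congr1 fine) := E.
have fx : S (fun i => `|x i|) \is a fin_num by apply: S_fin.
have fpx : S (fun i => `|x i| + x i) \is a fin_num.
  exact: S_fin (pos_ge0 x) (pos_lty sx).
rewrite (fineD fpx (S_fin q0 sq)) (fineD (S_fin p0 sp) fx) => {}E.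
rewrite /rsum -/(S _) -/(S (fun i => `|x i|)); apply/eqP.
by rewrite subr_eq addrAC eq_sym subr_eq eq_sym E.
Qed.

Lemma abs_summable_linear (c : R) x y : abs_summable x -> abs_summable y ->
  abs_summable (fun i => c * x i + y i).
Proof.
move=> sx sy; apply: (@le_lt_trans _ _ (S (fun i => `|c| * `|x i| + `|y i|))).
  by apply: leS => i; rewrite (le_trans (ler_normD _ _))// normrM.
have cx0 i : 0 <= `|c| * `|x i| by rewrite mulr_ge0.
by rewrite SD// SZ// lte_add_pinfty// lte_mul_pinfty ?lee_fin.
Qed.

Lemma rsum_linear (c : R) x y : abs_summable x -> abs_summable y ->
  rsum (fun i => c * x i + y i) = c * rsum x + rsum y.
Proof.
move=> sx sy.
have [px py] := (pos_lty sx, pos_lty sy).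
have [fpx fpy] := (S_fin (pos_ge0 x) px, S_fin (pos_ge0 y) py).
have nx i : 0 <= `|x i| by []. have ny i : 0 <= `|y i| by [].
have [fnx fny] := (S_fin nx sx, S_fin ny sy).
have L (d : R) (p q : I -> R) : 0 <= d -> (forall i, 0 <= p i) ->
   (forall i, 0 <= q i) -> (S p < +oo)%E -> (S q < +oo)%E ->
   (forall i, 0 <= d * p i + q i) /\ (S (fun i => d * p i + q i)%R < +oo)%E /\
   fine (S (fun i => d * p i + q i)) = d * fine (S p) + fine (S q).
  move=> d0 p0 q0 sp sq; have dp0 i : 0 <= d * p i by rewrite mulr_ge0.
  have fp : S p \is a fin_num by apply: S_fin.
  have fq : S q \is a fin_num by apply: S_fin.
  split; first by move=> i; rewrite addr_ge0.
  rewrite SD// SZ//; split.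
    by rewrite lte_add_pinfty// lte_mul_pinfty ?lee_fin.
  by rewrite fineD ?fin_numM// fineM.
have [c0|/ltW c0] := leP 0 c.
  have [p0 [p1 p2]] := L c _ _ c0 (pos_ge0 x) (pos_ge0 y) px py.
  have [q0 [q1 q2]] := L c _ _ c0 nx ny sx sy.
  rewrite (rsumE p0 q0 p1 q1) => [|i]; last by ring.
  by rewrite p2 q2 /rsum -/(S _); ring.
have nc0 : 0 <= - c by rewrite oppr_ge0.
have [p0 [p1 p2]] := L (- c) _ _ nc0 nx (pos_ge0 y) sx py.
have [q0 [q1 q2]] := L (- c) _ _ nc0 (pos_ge0 x) ny px sy.
rewrite (rsumE p0 q0 p1 q1) => [|i]; last by ring.
by rewrite p2 q2 /rsum -/(S _); ring.
Qed.

Lemma ler_abs_rsum x : abs_summable x ->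
  (`|rsum x|%:E <= \esum_(i in [set: I]) `|x i|%:E)%E.
Proof.
move=> sx; have px := pos_lty sx; have fpx := S_fin (pos_ge0 x) px.
have nx i : 0 <= `|x i| by []. have fnx := S_fin nx sx.
rewrite -/(S _) -(fineK fnx) lee_fin /rsum -/(S _) -/(S (fun i => `|x i|)).
have : 0 <= fine (S (fun i => `|x i| + x i)) by rewrite fine_ge0// S_ge0.
have : fine (S (fun i => `|x i| + x i)) <=
    fine (S (fun i => `|x i|)) + fine (S (fun i => `|x i|)).
  rewrite -lee_fin EFinD !fineK// -SD//.
  by apply: leS => i; rewrite lerD2l ler_norm.
by move=> h1 h2; rewrite ler_norml; apply/andP; split; lra.
Qed.

Lemma rsum_finite_support x (X : set I) : finite_set X ->
  (forall i, ~ X i -> x i = 0) -> rsum x = \sum_(i <- fset_set X) x i.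
Proof.
move=> finX xX; rewrite /rsum (esum_finite_support finX)//; last first.
  by move=> i /xX ->; rewrite normr0 addr0.
rewrite (esum_finite_support finX)//; last by move=> i /xX ->; rewrite normr0.
by rewrite /= big_split/= addrAC subrr add0r.
Qed.

Definition csum f : R[i] :=
  Complex (rsum (fun i => complex.Re (f i))) (rsum (fun i => complex.Im (f i))).

Definition cabs_summable f : Prop :=
  (\esum_(i in [set: I]) (modulus (f i))%:E < +oo)%E.

Lemma le_Re_modulus z : `|complex.Re z| <= modulus z.
Proof.
case: z => a b; rewrite /modulus /= -sqrtr_sqr.
by rewrite ler_sqrt ?addr_ge0 ?sqr_ge0// lerDl sqr_ge0.
Qed.

Lemma le_Im_modulus z : `|complex.Im z| <= modulus z.
Proof.
case: z => a b; rewrite /modulus /= -sqrtr_sqr.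
by rewrite ler_sqrt ?addr_ge0 ?sqr_ge0// lerDr sqr_ge0.
Qed.

Lemma cabs_summableRe f : cabs_summable f ->
  abs_summable (fun i => complex.Re (f i)).
Proof. by apply: le_lt_trans; apply: leS => i; exact: le_Re_modulus. Qed.

Lemma cabs_summableIm f : cabs_summable f ->
  abs_summable (fun i => complex.Im (f i)).
Proof. by apply: le_lt_trans; apply: leS => i; exact: le_Im_modulus. Qed.

Lemma csum_linear z f g : cabs_summable f -> cabs_summable g ->
  csum (fun i => z * f i + g i) = z * csum f + csum g.
Proof.
move=> sf sg; have [fr fi] := (cabs_summableRe sf, cabs_summableIm sf).
have [gr gi] := (cabs_summableRe sg, cabs_summableIm sg).
case: z => a b; rewrite /csum.
have -> : (fun i => complex.Re (Complex a b * f i + g i)) =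
  (fun i => a * complex.Re (f i) +
    ((- b) * complex.Im (f i) + complex.Re (g i))).
  by apply/funext => i; case: (f i) => ? ?; case: (g i) => ? ? /=; ring.
have -> : (fun i => complex.Im (Complex a b * f i + g i)) =
  (fun i => a * complex.Im (f i) + (b * complex.Re (f i) + complex.Im (g i))).
  by apply/funext => i; case: (f i) => ? ?; case: (g i) => ? ? /=; ring.
rewrite !rsum_linear//; try exact: abs_summable_linear.
by apply/eqP; rewrite eq_complex /=; apply/andP; split; apply/eqP; ring.
Qed.

(** The factor 2 comes from treating the real and imaginary parts
    separately. *)
Lemma modulus_csum_le f : cabs_summable f ->
  ((modulus (csum f))%:E <=
   \esum_(i in [set: I]) (2 * modulus (f i))%:E)%E.
Proof.
move=> sf; apply: (@le_trans _ _
  (`|rsum (fun i => complex.Re (f i))| +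
   `|rsum (fun i => complex.Im (f i))|)%:E).
  rewrite lee_fin /csum /modulus /=; move: (rsum _) (rsum _) => b a.
  have ab0 : 0 <= `|a| + `|b| by rewrite addr_ge0.
  rewrite -[leRHS](ger0_norm ab0) -[leRHS]sqrtr_sqr ler_sqrt ?sqr_ge0//.
  rewrite sqrrD !real_normK ?num_real// addrAC lerDl.
  by rewrite mulrn_wge0// mulr_ge0.
rewrite EFinD -[leRHS]/(S _) (_ : S _ =
    S (fun i => modulus (f i) + modulus (f i))); last first.
  by congr S; apply/funext => i; rewrite mulr_natl mulr2n.
rewrite SD//; try by move=> i; exact: modulus_ge0.
apply: leeD.
  apply: le_trans (ler_abs_rsum (cabs_summableRe sf)) _.
  by apply: leS => i; exact: le_Re_modulus.
apply: le_trans (ler_abs_rsum (cabs_summableIm sf)) _.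
by apply: leS => i; exact: le_Im_modulus.
Qed.

Lemma csum_finite_support f (X : set I) : finite_set X ->
  (forall i, ~ X i -> f i = 0) -> csum f = \sum_(i <- fset_set X) f i.
Proof.
move=> finX fX; rewrite /csum !(rsum_finite_support finX); try by
  move=> i /fX ->.
elim/big_rec3: _ => [//|i a b c _ <-]; case: (f i) => ? ?.
by apply/eqP; rewrite eq_complex /= !eqxx.
Qed.

End AbsoluteSum.

(** * Convolution and operators on the square summable functions *)

Section Convolution.
Context {R : realType} {G : groupType}.
Implicit Types (f g h xi eta : G -> R[i]) (u v w : G -> R) (l : G -> R).

Let mod_ge0 f : forall a, 0 <= modulus (f a).
Proof. by move=> a; exact: modulus_ge0. Qed.

Lemma l2normE xi : l2norm xi = nrm (fun a => modulus (xi a)).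
Proof. by []. Qed.

Lemma l2norm_real u : (forall a, 0 <= u a) ->
  l2norm (fun a => (u a)%:C%C) = nrm u.
Proof. by move=> u0; apply: eq_nrm => a; rewrite modulus_real ger0_norm. Qed.

Lemma ell2_nrm xi : ell2 xi <-> (nrm (fun a => modulus (xi a)) < +oo)%E.
Proof.
rewrite /ell2 /= /l2sum /nrm; have := sqr_esum_ge0 (fun a => modulus (xi a)).
by move: (esum _ _) => [r| |]//=; rewrite !ltry.
Qed.

Lemma l2normZ (z : R[i]) xi :
  l2norm (fun a => z * xi a) = ((modulus z)%:E * l2norm xi)%E.
Proof.
rewrite !l2normE -nrmZ ?modulus_ge0//.
by apply: eq_nrm => a; rewrite modulusM.
Qed.

Lemma ell2_scale (z : R[i]) xi : ell2 xi -> ell2 (fun a => z * xi a).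
Proof.
move=> /ell2_nrm xi2; apply/ell2_nrm; rewrite -l2normE l2normZ.
by rewrite lte_mul_pinfty ?lee_fin ?modulus_ge0.
Qed.

Lemma finite_modulus f : group_algebra f ->
  finite_set [set a | modulus (f a) != 0].
Proof.
apply: sub_finite_set => a /=.
by apply: contraNN => /eqP ->; rewrite modulus0.
Qed.

Lemma group_algebra_ell2 f : group_algebra f -> ell2 f.
Proof. by move=> /finite_modulus ff; apply/ell2_nrm/nrm_lty. Qed.

Lemma group_algebra_real u :
  finite_set [set a | u a != 0] -> group_algebra (fun a => (u a)%:C%C).
Proof.
by apply: sub_finite_set => a; rewrite /supp/=; apply: contraNN => /eqP ->.
Qed.

Lemma delta_group_algebra (b : G) : group_algebra (delta b : G -> R[i]).
Proof.
apply: sub_finite_set (finite_set1 b) => a; rewrite /supp /delta /=.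
by case: (a =P b) => // _; rewrite eqxx.
Qed.

Lemma l2norm_delta (b : G) : l2norm (delta b : G -> R[i]) = 1%E.
Proof.
rewrite l2normE (nrm_finite_support (finite_set1 b)); last first.
  by move=> a /eqP/negbTE ab; rewrite /delta ab modulus0.
rewrite fset_set1 big_seq_fset1 /delta eqxx.
have -> : modulus (true%:R : R[i]) = 1 by exact: Normc.normc1.
by rewrite expr1n sqrtr1.
Qed.

Lemma ell2_0 : ell2 (fun _ : G => 0 : R[i]).
Proof.
apply: group_algebra_ell2; apply: sub_finite_set (finite_set0 G) => a /=.
by rewrite /supp/= eqxx.
Qed.

Lemma sobolev_normE l (s : R) f :
  sobolev_norm l s f = snrm l s (fun a => modulus (f a)).
Proof.
rewrite /sobolev_norm /snrm /nrm; congr sqrte; apply: eq_esum => a _.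
by rewrite exprMn -[(_ `^ s) ^+ 2]powR_mulrn ?powR_ge0// -powRrM (mulrC s).
Qed.

Lemma sobolev_snrm l (s : R) xi : sobolev l s xi ->
  (snrm l s (fun a => modulus (xi a)) < +oo)%E.
Proof.
rewrite -sobolev_normE /sobolev /= /sobolev_norm.
by case: (sobolev_sum l s xi) => [r| |]//=; rewrite !ltry.
Qed.

(** Rescale xi to a unit vector. *)
Lemma le_opnorm T xi :
  (forall (z : R[i]) eta, ell2 eta ->
    T (fun a => z * eta a) = (fun a => z * T eta a)) ->
  ell2 xi -> (l2norm (T xi) <= opnorm T * l2norm xi)%E.
Proof.
move=> Tz xi2; have := (ell2_nrm xi).1 xi2; rewrite -l2normE.
case E : (l2norm xi) => [r| |]// _; last first.
  by have := nrm_ge0 (fun a => modulus (xi a)); rewrite -l2normE E.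
have r0 : 0 <= r by rewrite -lee_fin -E l2normE nrm_ge0.
have [rz|rz] := eqVneq r 0.
  have xi0 a : xi a = 0.
    apply: Normc.eq0_normc; rewrite rz in E.
    exact: (nrm_eq0 (u := fun a => modulus (xi a)) (mod_ge0 xi)).
  have -> : xi = (fun a => 0 * xi a) by apply/funext => a; rewrite xi0 mulr0.
  by rewrite Tz// l2normZ modulus0 mul0e rz mule0.
have rp : 0 < r by rewrite lt0r rz.
pose xi' a := (r^-1)%:C%C * xi a.
have xi'1 : l2norm xi' = 1%E.
  by rewrite l2normZ modulus_real ger0_norm ?invr_ge0// E -EFinM mulVf.
have -> : xi = (fun a => r%:C%C * xi' a).
  by apply/funext => a; rewrite /xi' mulrA -rmorphM mulfV// mul1r.
have xi'2 : ell2 xi' by exact: ell2_scale.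
rewrite Tz// l2normZ modulus_real ger0_norm// muleC lee_wpmul2r ?lee_fin//.
by apply: ereal_sup_ubound; exists xi'.
Qed.

Lemma convolZ f (z : R[i]) xi :
  convol f (fun a => z * xi a) = (fun a => z * convol f xi a).
Proof.
apply/funext => a; rewrite /convol mulr_fsumr.
by apply: eq_fsbigr => m _; rewrite mulrCA.
Qed.

Lemma l2norm_convol f g : group_algebra g ->
  (l2norm (convol f g) <= opnorm (convol f) * l2norm g)%E.
Proof.
move=> gg; apply: le_opnorm; last exact: group_algebra_ell2.
by move=> z eta _; exact: convolZ.
Qed.

Lemma modulus_convol f g a : ((modulus (convol f g a))%:E <=
  \esum_(m in [set: G]) (modulus (f m) * modulus (g (m^-1 * a)%g))%:E)%E.
Proof.
apply: (le_trans (modulus_fsum _)); apply: le_esum => m _.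
by rewrite modulusM.
Qed.

Lemma modulus_convol_nrm f g a :
  ((modulus (convol f g a))%:E <= l2norm f * l2norm g)%E.
Proof.
apply: (le_trans (modulus_convol _ _ _)).
have := cauchy_schwarz (mod_ge0 f) (v := fun m => modulus (g (m^-1 * a)%g)).
move=> /(_ (fun m => modulus_ge0 _)) h; apply: (le_trans h).
by rewrite (nrm_reindex (fun b => modulus (g b)) (mulVg_bij a)).
Qed.

Lemma convol_finite f g a (U : set G) : finite_set U ->
  (forall m, ~ U m -> f m = 0) ->
  convol f g a = \sum_(m <- fset_set U) f m * g (m^-1 * a)%g.
Proof.
move=> finU fU; rewrite /convol (fsum_finite_support finU)// => m /fU ->.
by rewrite mul0r.
Qed.

Lemma convol_deltar f (a b : G) : convol f (delta b) a = f (a * b^-1)%g.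
Proof.
rewrite /convol /delta -(fsbig_widen [set (a * b^-1)%g]) ?fsbig_set1//.
  by rewrite invgM invgK mulgVK eqxx mulr1.
move=> m [_ /= mab]; case: eqP; rewrite ?mulr0// => E; case: mab.
by rewrite -E invgM invgK mulVKg.
Qed.

Lemma triformE_finite u v w (U W : set G) : finite_set U -> finite_set W ->
  (forall a, ~ U a -> u a = 0) -> (forall a, ~ W a -> w a = 0) ->
  (forall a, 0 <= u a) -> (forall a, 0 <= v a) -> (forall a, 0 <= w a) ->
  triform u v w = (\sum_(b <- fset_set W) w b *
     \sum_(a <- fset_set U) u a * v (a^-1 * b)%g)%:E.
Proof.
move=> finU finW uU wW u0 v0 w0; rewrite triform_right//.
transitivity (\esum_(b in [set: G])
   (w b * \sum_(a <- fset_set U) u a * v (a^-1 * b)%g)%:E).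
  apply: eq_esum => b _; rewrite EFinM (esum_finite_support finU)//.
    by move=> a; rewrite mulr_ge0.
  by move=> a /uU ->; rewrite mul0r.
rewrite (esum_finite_support finW)//.
  by move=> b; rewrite mulr_ge0// sumr_ge0// => a _; rewrite mulr_ge0.
by move=> b /wW ->; rewrite mul0r.
Qed.

(** Evaluating a convolution at 1 pairs m with m^-1, hence the inversion in the
    last factor. *)
Lemma convol_triform u v w : finite_set [set a | u a != 0] ->
  finite_set [set a | w a != 0] ->
  (forall a, 0 <= u a) -> (forall a, 0 <= v a) -> (forall a, 0 <= w a) ->
  triform u v w = (modulus (convol (convol (fun a => (u a)%:C%C)
    (fun a => (v a)%:C%C)) (fun a => (w a^-1%g)%:C%C) 1%g))%:E.
Proof.
move=> fu fw u0 v0 w0.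
rewrite (triformE_finite fu fw)//; try exact: out_support.
congr EFin; rewrite /convol (fsum_finite_support fw); last first.
  by move=> m Wm; rewrite mulg1 invgK (out_support Wm) mulr0.
rewrite (eq_bigr (fun m => (w m * \sum_(a <- fset_set [set a | u a != 0])
   u a * v (a^-1 * m)%g)%:C%C)); last first.
  move=> m _; rewrite mulg1 invgK mulrC rmorphM/=; congr (_ * _).
  rewrite (fsum_finite_support fu); last first.
    by move=> a Ua; rewrite (out_support Ua) mul0r.
  by rewrite rmorph_sum; apply: eq_bigr => a _; rewrite rmorphM.
rewrite -rmorph_sum modulus_real ger0_norm// sumr_ge0// => b _.
by rewrite mulr_ge0// sumr_ge0// => a _; rewrite mulr_ge0.
Qed.

Lemma nrm_inv w : nrm (fun a => w a^-1%g) = nrm w.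
Proof.
rewrite -(nrm_reindex w (mulVg_bij 1%g)).
by apply: eq_nrm => a /=; rewrite mulg1.
Qed.

Lemma modulus_inner_le xi eta a : ((modulus (inner (lreg a xi) eta))%:E <=
  \esum_(b in [set: G]) (modulus (xi (a^-1 * b)%g) * modulus (eta b))%:E)%E.
Proof.
apply: (le_trans (modulus_sum_le _)); apply: le_esum => b _.
by rewrite modulusM modulus_conj.
Qed.

Lemma inner_real v w a : (forall a, 0 <= v a) -> (forall a, 0 <= w a) ->
  finite_set [set a | w a != 0] ->
  (\esum_(b in [set: G]) (v (a^-1 * b)%g * w b)%:E = (modulus (inner
    (lreg a (fun b => (v b)%:C%C)) (fun b => (w b)%:C%C)))%:E)%E.
Proof.
move=> v0 w0 fw.
rewrite (esum_finite_support fw); last 2 first.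
- by move=> b; rewrite mulr_ge0.
- by move=> b Wb; rewrite (out_support Wb) mulr0.
congr EFin; rewrite /inner (sum_finite_support fw); last first.
  by move=> b Wb; rewrite (out_support Wb) conjc0 mulr0.
rewrite (eq_bigr (fun b => (v (a^-1 * b)%g * w b)%:C%C)); last first.
  by move=> b _; rewrite rmorphM; congr (_ * _); exact: conjc_real.
rewrite -rmorph_sum modulus_real ger0_norm// sumr_ge0// => b _.
by rewrite mulr_ge0.
Qed.

End Convolution.

(** * Each condition bounds the convolution form *)

Section BoundsOnTheForm.
Context {R : realType} {G : groupType}.
Implicit Types (f g h xi eta : G -> R[i]) (u v w : G -> R) (l : G -> R).

(** Makes the constants and exponents of the conditions nonnegative. *)
Lemma pow_normalize (C D : R) n : (1 <= n)%N ->
  C * n%:R `^ D <= `|C| * n%:R `^ `|D|.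
Proof.
move=> n1; apply: (le_trans (ler_wpM2r (powR_ge0 _ _) (ler_norm C))).
by rewrite ler_wpM2l// ler_powR ?ler_norm// ler1n.
Qed.

Lemma opnorm_bound_convol (K : R) f :
  (opnorm (convol f) <= K%:E * l2norm f)%E -> forall g, group_algebra g ->
  (l2norm (convol f g) <= K%:E * l2norm f * l2norm g)%E.
Proof.
move=> h g gg; apply: (le_trans (l2norm_convol _ gg)).
by apply: lee_wpmul2r => //; exact: nrm_ge0.
Qed.

Lemma convol3_bound (K : R) f g h :
  (l2norm (convol f g) <= K%:E * l2norm f * l2norm g)%E ->
  ((modulus (convol (convol f g) h 1%g))%:E <=
    K%:E * l2norm f * l2norm g * l2norm h)%E.
Proof.
move=> hK; apply: (le_trans (modulus_convol_nrm _ _ _)).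
by apply: lee_wpmul2r => //; exact: nrm_ge0.
Qed.

Lemma convol3_ball l (C D : R) :
  (forall n : nat, (1 <= n)%N ->
     forall f g h : G -> R[i],
       group_algebra f -> group_algebra g -> group_algebra h ->
       supp f `<=` length_ball l n%:R ->
       ((modulus (convol (convol f g) h 1%g))%:E
          <= (C * n%:R `^ D)%:E * l2norm f * l2norm g * l2norm h)%E) ->
  ball_triform_bounded l `|C| `|D|.
Proof.
move=> hb n n1 u v w u0 v0 w0 fu fv fw ul.
have wV0 a : 0 <= w a^-1%g by [].
have fwV : finite_set [set a | w a^-1%g != 0].
  have := finite_image (fun a => a^-1%g) fw; apply: sub_finite_set => a /= wa.
  by exists a^-1%g => //; rewrite invgK.
rewrite convol_triform//; apply: (le_trans (hb n n1 _ _ _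
  (group_algebra_real fu) (group_algebra_real fv) (group_algebra_real fwV) _)).
  by move=> a; rewrite /supp/= => ua; apply: ul; apply: contraNN ua => /eqP ->.
rewrite !l2norm_real// nrm_inv -!muleA; apply: lee_wpmul2r.
  by rewrite !mule_ge0// nrm_ge0.
by rewrite lee_fin pow_normalize.
Qed.

(** The form is the pairing of u with the coefficients of v and w, and only the
    ball containing the support of u contributes; Cauchy-Schwarz applies
    there. *)
Lemma coeff_triform_unit l (K : R) (n : nat) u v w : 0 <= K ->
  (forall a, 0 <= u a) -> (forall a, 0 <= v a) -> (forall a, 0 <= w a) ->
  finite_set [set a | w a != 0] -> (forall a, u a != 0 -> l a <= n%:R) ->
  (\esum_(a in length_ball l n%:R) (modulus (inner
    (lreg a (fun b => (v b)%:C%C)) (fun b => (w b)%:C%C)) ^+ 2)%:E <=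
    (K ^+ 2)%:E)%E ->
  (triform u v w <= K%:E * nrm u)%E.
Proof.
move=> K0 u0 v0 w0 fw ul hK; rewrite triform_left//.
set p := fun a => modulus (inner
  (lreg a (fun b => (v b)%:C%C)) (fun b => (w b)%:C%C)).
have p0 a : 0 <= p a by exact: modulus_ge0.
rewrite (eq_esum (b := fun a =>
    (u a * cut (length_ball l n%:R) p a)%:E)); last first.
  move=> a _; rewrite inner_real// -EFinM; congr EFin; rewrite /cut.
  have [->|ua] := eqVneq (u a) 0; first by rewrite !mul0r.
  by rewrite mem_set//; exact: ul.
apply: (le_trans (cauchy_schwarz u0 (cut_ge0 _ p0))); rewrite muleC.
apply: lee_wpmul2r; first exact: nrm_ge0.
have -> : K%:E = sqrte (K ^+ 2)%:E by rewrite /= sqrtr_sqr ger0_norm.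
rewrite lee_sqrt ?lee_fin ?sqr_ge0//; apply: le_trans hK.
rewrite [leRHS]esum_mkcond; apply: le_esum => a _; rewrite /cut.
by case: ifP; rewrite ?expr0n.
Qed.

(** Normalize v and w, which is possible unless one of them vanishes. *)
Lemma coeff_triform_ball l (C D : R) :
  (forall n : nat, (1 <= n)%N ->
     forall xi eta : G -> R[i], ell2 xi -> ell2 eta ->
       l2norm xi = 1%E -> l2norm eta = 1%E ->
       (\esum_(a in length_ball l n%:R)
          (modulus (inner (lreg a xi) eta) ^+ 2)%:E
        <= (C * n%:R `^ (2 * D))%:E)%E) ->
  ball_triform_bounded l (Num.sqrt `|C|) `|D|.
Proof.
move=> hb n n1 u v w u0 v0 w0 fu fv fw ul.
have nfin t : finite_set [set a : G | t a != 0] -> nrm t = (fine (nrm t))%:E.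
  by move=> ft; rewrite fineK// ge0_fin_numE ?nrm_ge0// nrm_lty.
have K0 : 0 <= Num.sqrt `|C| * n%:R `^ `|D|.
  by rewrite mulr_ge0 ?sqrtr_ge0 ?powR_ge0.
have RHS0 : (0 <= (Num.sqrt `|C| * n%:R `^ `|D|)%:E *
    (nrm u * (nrm v * nrm w)))%E.
  by rewrite !mule_ge0 ?nrm_ge0 ?lee_fin.
have [v00|vn] := eqVneq (nrm v) 0%E.
  by rewrite triform0//; apply: Or32; exact: nrm_eq0 v00.
have [w00|wn] := eqVneq (nrm w) 0%E.
  by rewrite triform0//; apply: Or33; exact: nrm_eq0 w00.
set r := fine (nrm v); set t := fine (nrm w).
have Er : nrm v = r%:E by exact: nfin.
have Et : nrm w = t%:E by exact: nfin.
have r0 : 0 < r.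
  by rewrite -lte_fin -Er lt0e vn nrm_ge0.
have t0 : 0 < t.
  by rewrite -lte_fin -Et lt0e wn nrm_ge0.
pose v' a := r^-1 * v a; pose w' a := t^-1 * w a.
have v'0 a : 0 <= v' a by rewrite mulr_ge0// invr_ge0 ltW.
have w'0 a : 0 <= w' a by rewrite mulr_ge0// invr_ge0 ltW.
have v'1 : nrm v' = 1%E.
  by rewrite nrmZ ?invr_ge0 ?ltW// Er -EFinM mulVf ?gt_eqF.
have w'1 : nrm w' = 1%E.
  by rewrite nrmZ ?invr_ge0 ?ltW// Et -EFinM mulVf ?gt_eqF.
have fw' : finite_set [set a | w' a != 0].
  apply: sub_finite_set fw => a /=; apply: contraNN => /eqP.
  by rewrite /w' => ->; rewrite mulr0.
have : (triform u v' w' <= (Num.sqrt `|C| * n%:R `^ `|D|)%:E * nrm u)%E.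
  apply: (coeff_triform_unit (l := l) (n := n)) => //.
  apply: (le_trans (hb n n1 _ _ _ _ _ _)).
  - by apply/ell2_nrm; rewrite -l2normE l2norm_real// v'1 ltry.
  - by apply/ell2_nrm; rewrite -l2normE l2norm_real// w'1 ltry.
  - by rewrite l2norm_real.
  - by rewrite l2norm_real.
  rewrite lee_fin exprMn sqr_sqrtr// -[(_ `^ _) ^+ 2]powR_mulrn ?powR_ge0//.
  rewrite -powRrM (mulrC `|D|) -[X in X * `|D|](normr_nat R 2) -normrM.
  exact: pow_normalize.
have -> : triform u v w =
    triform (fun a => 1 * u a) (fun a => r * v' a) (fun a => t * w' a).
  rewrite (_ : (fun a => 1 * u a) = u); last first.
    by apply/funext => a; rewrite mul1r.
  rewrite (_ : (fun a => r * v' a) = v); last first.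
    by apply/funext => a; rewrite /v' mulrA mulfV ?mul1r// gt_eqF.
  rewrite (_ : (fun a => t * w' a) = w)//.
  by apply/funext => a; rewrite /w' mulrA mulfV ?mul1r// gt_eqF.
rewrite triformZ ?(ltW r0) ?(ltW t0)// mul1r.
move=> h; apply: (le_trans (lee_wpmul2l _ h)).
  by rewrite lee_fin mulr_ge0 ?ltW.
by rewrite Er Et -EFinM muleC muleA.
Qed.

Lemma bounded_operator0 T : bounded_operator T ->
  T (fun=> 0 : R[i]) = (fun=> 0) :> (G -> R[i]).
Proof.
move=> [_ Tlin _]; have := Tlin 1 _ _ ell2_0 ell2_0.
rewrite [X in T X = _](_ : _ = (fun=> 0)); last first.
  by apply/funext => a; rewrite mulr0 addr0.
move=> E; apply/funext => a; have := congr1 (@^~ a) E => /=.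
by rewrite mul1r => /eqP; rewrite -subr_eq0 opprD addNKr oppr_eq0 => /eqP.
Qed.

Lemma bounded_operatorZ T (z : R[i]) eta : bounded_operator T -> ell2 eta ->
  T (fun a => z * eta a) = (fun a => z * T eta a) :> (G -> R[i]).
Proof.
move=> bT eta2; have [_ Tlin _] := bT.
have := Tlin z _ _ eta2 ell2_0; rewrite bounded_operator0//.
rewrite [X in T X = _](_ : _ = (fun a => z * eta a)); last first.
  by apply/funext => a; rewrite addr0.
by move=> ->; apply/funext => a; rewrite addr0.
Qed.

Lemma bounded_operator_sum T (r : seq G) (c : G -> R[i]) :
  bounded_operator T ->
  T (fun a => \sum_(m <- r) c m * delta m a) =
  (fun a => \sum_(m <- r) c m * T (delta m) a).
Proof.
move=> bT; have [_ Tlin _] := bT.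
elim: r => [|m r IH].
  rewrite [X in T X](_ : _ = (fun=> 0)); last first.
    by apply/funext => a; rewrite big_nil.
  by rewrite bounded_operator0//; apply/funext => a; rewrite big_nil.
rewrite [X in T X](_ : _ =
    (fun a => c m * delta m a + \sum_(m <- r) c m * delta m a)).
  rewrite Tlin ?IH.
  - by apply/funext => a; rewrite big_cons.
  - exact/group_algebra_ell2/delta_group_algebra.
  - apply: group_algebra_ell2; apply: sub_finite_set (finite_seq r) => a.
    rewrite /supp/=; apply: contraNT => ar; apply/eqP.
    rewrite big_seq big1// => k kr; rewrite /delta.
    by case: eqP => [ak|_]; rewrite ?mulr0//; rewrite ak kr in ar.
by apply/funext => a; rewrite big_cons.
Qed.

(** T is a limit of left convolutions, which commute with right
    translations. *)
Lemma reduced_delta T (a b : G) : reduced_cstar_operator T ->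
  T (delta b) a = T (delta 1%g) (a * b^-1)%g :> R[i].
Proof.
move=> [_ approx]; apply/eqP; rewrite -subr_eq0; apply/eqP/Normc.eq0_normc.
apply/eqP; rewrite eq_le modulus_ge0 andbT; apply/ler_addgt0Pr => e e0.
have [f ff fe] := approx _ (divr_gt0 e0 (ltr0n _ 2)).
have close (c d : G) : modulus (T (delta c) d - f (d * c^-1)%g) <= e / 2.
  rewrite -lee_fin; apply: le_trans (ltW fe); rewrite -convol_deltar.
  apply: (@le_trans _ _
    (l2norm (fun x => T (delta c) x - convol f (delta c) x))).
    exact: (le_coord_nrm (u := fun x => modulus (_ x - _ x)) (modulus_ge0 _)).
  apply: ereal_sup_ubound; exists (delta c) => //.
  split; last exact: l2norm_delta.
  exact/group_algebra_ell2/delta_group_algebra.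
rewrite add0r [e]splitr.
have := close 1%g (a * b^-1)%g; rewrite invg1 mulg1 => h1.
apply: (le_trans _ (lerD (close b a) h1)).
rewrite -[X in _ <= _ + X]modulusN; apply: (le_trans _ (modulusD _ _)).
by rewrite opprB addrA subrK.
Qed.

(** For finitely supported v, the function T v is the convolution of u and v by
    linearity and translation invariance. *)
Lemma reduced_triform T u v w : reduced_cstar_operator T ->
  T (delta 1%g) = (fun a => (u a)%:C%C) ->
  (forall a, 0 <= u a) -> (forall a, 0 <= v a) -> (forall a, 0 <= w a) ->
  finite_set [set a | v a != 0] ->
  (triform u v w <= opnorm T * (nrm v * nrm w))%E.
Proof.
move=> rT Tu u0 v0 w0 fv; have [bT _] := rT.
set V := fset_set [set a | v a != 0].
have Tv b : T (fun a => (v a)%:C%C) b =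
    (\sum_(m <- V) v m * u (b * m^-1)%g)%:C%C.
  rewrite (_ : (fun a => (v a)%:C%C) =
      (fun a => \sum_(m <- V) (v m)%:C%C * delta m a)).
    rewrite bounded_operator_sum// rmorph_sum; apply: eq_bigr => m _.
    by rewrite (reduced_delta _ _ rT) Tu rmorphM.
  apply/funext => a; have [Va|Va] := pselect ([set a | v a != 0] a).
    rewrite (big_fsetD1 a)/=; last by rewrite in_fset_set// inE.
    rewrite /delta eqxx mulr1 big1_fset ?addr0// => m.
    rewrite !inE => /andP[ma _] _.
    by rewrite eq_sym (negbTE ma) mulr0.
  rewrite (out_support Va) big1_fset// => m; rewrite in_fset_set// inE => Vm _.
  by rewrite /delta; case: eqP => [am|]; rewrite ?mulr0//; rewrite am in Va.
have modTv b : (\esum_(a in [set: G]) (u a * v (a^-1 * b)%g)%:E =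
    (modulus (T (fun a => (v a)%:C%C) b))%:E)%E.
  rewrite Tv modulus_real ger0_norm; last first.
    by rewrite sumr_ge0// => m _; rewrite mulr_ge0.
  rewrite -(esum_finite_support (u := fun m => v m * u (b * m^-1)%g) fv).
  - rewrite [RHS](reindex_esum [set: G] [set: G] (fun a => (a^-1 * b)%g)).
      by apply: eq_esum => a _; rewrite invgM invgK mulVKg mulrC.
    exact: mulVg_bij.
  - by move=> m; rewrite mulr_ge0.
  - by move=> m Vm; rewrite (out_support Vm) mul0r.
rewrite triform_right// (eq_esum (b := fun b =>
    (w b * modulus (T (fun a => (v a)%:C%C) b))%:E)); last first.
  by move=> b _; rewrite modTv -EFinM.
apply: (le_trans (cauchy_schwarz w0 (fun b => modulus_ge0 _))).
rewrite muleA muleC; apply: lee_wpmul2r; first exact: nrm_ge0.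
rewrite -(l2norm_real v0); apply: le_opnorm.
  by move=> z eta; exact: bounded_operatorZ.
exact/group_algebra_ell2/group_algebra_real.
Qed.

(** The ball bound with constant 4^k 2^k and exponent k fails for some
    functions.  On a ball of radius n, the factor 2^k n^k times the l^2 norm of
    u dominates its Sobolev norm of order k, so the form exceeds the Sobolev
    bound with constant 4^k; scaling the Sobolev norm of u down to 2^-k leaves
    a factor 2^k. *)
Lemma triform_unbounded_witness l (k : nat) : (forall a, 0 <= l a) ->
  ~ (exists C D : R, [/\ 0 <= C, 0 <= D & ball_triform_bounded l C D]) ->
  exists p : (G -> R) * (G -> R) * (G -> R),
    [/\ [/\ forall a, 0 <= p.1.1 a, forall a, 0 <= p.1.2 a
          & forall a, 0 <= p.2 a],
        finite_set [set a | p.1.1 a != 0], finite_set [set a | p.1.2 a != 0],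
        (snrm l k%:R p.1.1 <= (2 ^- k)%:E)%E &
        ((2 ^+ k)%:E * (nrm p.1.2 * nrm p.2) < triform p.1.1 p.1.2 p.2)%E].
Proof.
move=> l0 unb; apply: contrapT => nowit; apply: unb.
exists (4 ^+ k * 2 `^ k%:R), k%:R; split => //.
move=> n n1 u v w u0 v0 w0 fu fv fw ul; rewrite leNgt; apply/negP => big.
apply: nowit.
have big' : ((4 ^+ k)%:E * (snrm l k%:R u * (nrm v * nrm w)) < triform u v w)%E.
  apply: le_lt_trans big; rewrite -mulrA [in leRHS]EFinM -[leRHS]muleA.
  apply: lee_wpmul2l; first by rewrite lee_fin exprn_ge0.
  rewrite [leRHS]muleA; apply: lee_wpmul2r; first by rewrite mule_ge0// nrm_ge0.
  exact: snrm_ball.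
have fr : snrm l k%:R u \is a fin_num.
  by rewrite ge0_fin_numE ?snrm_ge0// snrm_lty.
move: fr; case Er : (snrm l k%:R u) => [r| |]// _.
have r0 : 0 <= r by rewrite -lee_fin -Er snrm_ge0.
have rp : 0 < r.
  rewrite lt0r r0 andbT; apply/eqP => rz; rewrite rz in Er.
  suff uz a : u a = 0.
    by move: big'; rewrite Er mul0e mule0 triform0 ?ltxx//; apply: Or31.
  have h := nrm_eq0 (fun a => mulr_ge0 (u0 a) (powR_ge0 (1 + l a) k%:R)) Er a.
  move/eqP: h; rewrite mulf_eq0.
  have lp : 0 < 1 + l a by rewrite ltr_pwDl.
  by rewrite (gt_eqF (powR_gt0 k%:R lp)) orbF => /eqP.
have c0 : 0 < 2 ^- k / r by rewrite divr_gt0// invr_gt0 exprn_gt0.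
exists ((fun a => 2 ^- k / r * u a), v, w); split => //=.
- by split=> // a; rewrite mulr_ge0// ltW.
- apply: sub_finite_set fu => a /=; apply: contraNN => /eqP ->.
  by rewrite mulr0.
- by rewrite snrmZ ?(ltW c0)// Er -EFinM divfK ?lt0r_neq0.
rewrite triformZl ?(ltW c0)//; move: big'.
rewrite -(@lte_pmul2l _ (2 ^- k / r)%:E) ?lte_fin//.
apply: le_lt_trans; rewrite Er !muleA -!EFinM -!muleA.
apply: lee_wpmul2r; first by rewrite mule_ge0// nrm_ge0.
rewrite lee_fin (_ : 4 = 2 * 2 :> R); last by rewrite -natrM.
have y0 : 2 ^+ k != 0 :> R by rewrite expf_neq0// pnatr_eq0.
rewrite exprMn; move: (2 ^+ k : R) y0 => y y0.
rewrite le_eqVlt; apply/orP; left; apply/eqP; field.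
by rewrite y0 lt0r_neq0.
Qed.

(** Exchanging the sums leaves the series of the squared Sobolev norms of order
    s of the U_k.  The finitely many terms with k <= s are finite, and the
    others are dominated by the norms of order k, hence by 2^-k. *)
Lemma square_sum_sobolev l (U : nat -> G -> R) (s : R) : (forall a, 0 <= l a) ->
  (forall k a, 0 <= U k a) -> (forall k, finite_set [set a | U k a != 0]) ->
  (forall k, snrm l k%:R (U k) <= (2 ^- k)%:E)%E ->
  (\esum_(a in [set: G]) \esum_(k in [set: nat])
     (U k a ^+ 2 * (1 + l a) `^ (2 * s))%:E < +oo)%E.
Proof.
move=> l0 U0 fU hU; rewrite esum_swap; last first.
  by move=> a k; rewrite lee_fin mulr_ge0 ?sqr_ge0 ?powR_ge0.
rewrite (eq_esum (b := fun k => (snrm l s (U k) ^+ 2)%E)); last first.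
  move=> k _; rewrite /snrm nrm_sqr; apply: eq_esum => a _.
  by rewrite exprMn -[(_ `^ s) ^+ 2]powR_mulrn ?powR_ge0// -powRrM (mulrC s).
have sq0 k : (0 <= snrm l s (U k) ^+ 2)%E by rewrite expe2 mule_ge0 ?snrm_ge0.
pose N := (Num.truncn s).+1.
rewrite (esumID [set k | (k < N)%N])// lte_add_pinfty//.
  have fI : finite_set [set k | (k < N)%N] := finite_II N.
  rewrite setTI esum_fset// fsbig_finite//.
  apply: lte_sum_pinfty => k _; have := snrm_lty l s (fU k).
  have := snrm_ge0 l s (U k); case: (snrm l s (U k)) => // r _ _.
  by rewrite -EFin_expe ltry.
apply: (@le_lt_trans _ _
  (\esum_(k in [set: nat]) (2 / (2 ^ k.+1)%:R)%:E)%E); last first.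
  rewrite -nneseries_esumT; last by move=> k; rewrite lee_fin divr_ge0.
  by apply: le_lt_trans (epsilon_trick0 xpredT _) _; rewrite ?ltry.
rewrite setTI [leLHS]esum_mkcond; apply: le_esum => k _.
case: ifPn => [|_]; last by rewrite lee_fin divr_ge0.
rewrite inE /= => /negP; rewrite -leqNgt => Nk.
have sk : s <= k%:R.
  have [s0|s0] := leP 0 s; last by apply: le_trans (ltW s0) _.
  have /andP[_ /ltW h] := truncn_itv s0; apply: le_trans h _.
  by rewrite ler_nat.
have hk : (snrm l s (U k) <= (2 ^- k)%:E)%E.
  exact: le_trans (le_snrm l0 (U0 k) sk) (hU k).
have -> : 2 / (2 ^ k.+1)%:R = 2 ^- k :> R.
  by rewrite expnS natrM natrX invfM mulrA mulfV ?mul1r// pnatr_eq0.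
have p0 : 0 <= 2 ^- k :> R by rewrite invr_ge0 exprn_ge0.
have p1 : 2 ^- k <= 1 :> R by rewrite invf_le1 ?exprn_gt0// exprn_ege1// ler1n.
apply: (@le_trans _ _ ((2 ^- k)%:E ^+ 2)%E).
  by rewrite !expe2 lee_pmul ?snrm_ge0.
by rewrite -EFin_expe lee_fin expr2 ler_piMr.
Qed.

(** Take the square root of the sum of the squares: it dominates each function,
    and its Sobolev norms are obtained by exchanging two sums of nonnegative
    terms. *)
Lemma rapid_dominant l (U : nat -> G -> R) : (forall a, 0 <= l a) ->
  (forall k a, 0 <= U k a) -> (forall k, finite_set [set a | U k a != 0]) ->
  (forall k, snrm l k%:R (U k) <= (2 ^- k)%:E)%E ->
  exists xi : G -> R, [/\ forall a, 0 <= xi a, forall k a, U k a <= xi a &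
    sobolev_infty l (fun a => (xi a)%:C%C)].
Proof.
move=> l0 U0 fU hU.
pose sq a : \bar R := \esum_(k in [set: nat]) (U k a ^+ 2)%:E.
have sq0 a : (0 <= sq a)%E by apply: esum_ge0 => k _; rewrite lee_fin sqr_ge0.
have sq_fin a : sq a \is a fin_num.
  rewrite ge0_fin_numE//.
  apply: le_lt_trans (square_sum_sobolev 0 l0 U0 fU hU).
  apply: esum_ge; exists [set a]; first by split=> //; exact: finite_set1.
  rewrite fsbig_set1; apply: le_esum => k _.
  by rewrite mulr0 powRr0 mulr1.
pose xi a := Num.sqrt (fine (sq a)).
have xi2 a : (xi a ^+ 2)%:E = sq a.
  by rewrite sqr_sqrtr ?fineK// fine_ge0.
exists xi; split=> [a|k a|s s0]; first exact: sqrtr_ge0.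
  rewrite -ler_sqr ?nnegrE ?sqrtr_ge0// -lee_fin xi2.
  apply: esum_ge; exists [set k]; first by split=> //; exact: finite_set1.
  by rewrite fsbig_set1.
apply: le_lt_trans (square_sum_sobolev s l0 U0 fU hU).
apply: le_esum => a _; rewrite modulus_real ger0_norm ?sqrtr_ge0//.
rewrite mulrC EFinM xi2 -esumZl ?powR_ge0//; last first.
  by move=> k; rewrite lee_fin sqr_ge0.
by apply: le_esum => k _; rewrite -EFinM mulrC.
Qed.

(** Otherwise some rapidly decreasing function dominates functions whose
    convolution norms exceed every 2^k; as it comes from a bounded operator,
    this is a contradiction. *)
Lemma reduced_ball l : (forall a, 0 <= l a) ->
  sobolev_infty l `<=` @reduced_cstar R G ->
  exists C D : R, [/\ 0 <= C, 0 <= D & ball_triform_bounded l C D].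
Proof.
move=> l0 incl; apply: contrapT => unb.
have /choice[F hF] := fun k => triform_unbounded_witness k l0 unb.
have [xi [xi0 Uxi /incl [T rT Txi]]] :=
  @rapid_dominant l (fun k => (F k).1.1) l0
  (fun k => let: And5 (And3 h _ _) _ _ _ _ := hF k in h)
  (fun k => let: And5 _ h _ _ _ := hF k in h)
  (fun k => let: And5 _ _ _ h _ := hF k in h).
have [[_ _ Tb] _] := rT.
(* The norm of T is finite, hence at most 2^k for some k. *)
have [k hk] : exists k, (opnorm T <= (2 ^+ k)%:E)%E.
  move: Tb; case: (opnorm T) => [r| |]// _; last by exists 0%N; exact: leNye.
  exists (Num.bound `|r|); rewrite lee_fin.
  apply: (le_trans (ler_norm r)).
  apply: (le_trans (ltW (archi_boundP (normr_ge0 r)))).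
  by rewrite -natrX ler_nat; exact/ltnW/ltn_expl.
have [[u0 v0 w0] _ fv _ big] := hF k.
suff : ((2 ^+ k)%:E * (nrm (F k).1.2 * nrm (F k).2) <
        (2 ^+ k)%:E * (nrm (F k).1.2 * nrm (F k).2))%E by rewrite ltxx.
apply: (lt_le_trans big); apply: (le_trans (le_triform (Uxi k) v0 w0)).
apply: (le_trans (reduced_triform rT Txi xi0 v0 w0 fv)).
by apply: lee_wpmul2r => //; rewrite mule_ge0 ?nrm_ge0.
Qed.

End BoundsOnTheForm.

(** * Consequences of a bound on the convolution form *)

Section ConsequencesOfTheBound.
Context {R : realType} {G : groupType}.
Implicit Types (f theta xi eta : G -> R[i]) (u v w : G -> R) (l : G -> R).

Let mod_ge0 f : forall a, 0 <= modulus (f a).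
Proof. by move=> a; exact: modulus_ge0. Qed.

Lemma triform_bounded_opnorm l (c s : R) f : triform_bounded l c s -> 0 <= c ->
  group_algebra f -> (opnorm (convol f) <= c%:E * sobolev_norm l s f)%E.
Proof.
move=> tb c0 ff; apply: ge_ereal_sup => _ [xi [xi2 xi1] <-].
rewrite sobolev_normE -[X in (_ <= _ * X)%E]mule1 -xi1 !l2normE.
exact: (triform_bounded_convol tb c0 (mod_ge0 f) (mod_ge0 xi) (mod_ge0 _)
  (snrm_lty l s (finite_modulus ff)) ((ell2_nrm xi).1 xi2)
  (modulus_convol f xi)).
Qed.

Lemma sobolev_ball l (c s : R) (n : nat) f : (1 <= n)%N -> 0 <= c -> 0 <= s ->
  (forall a, 0 <= l a) -> supp f `<=` length_ball l n%:R ->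
  (c%:E * sobolev_norm l s f <= (c * 2 `^ s * n%:R `^ s)%:E * l2norm f)%E.
Proof.
move=> n1 c0 s0 l0 fl; rewrite sobolev_normE -mulrA (EFinM c) -muleA.
apply: lee_wpmul2l; first by rewrite lee_fin.
apply: snrm_ball => // a fa; apply: fl; rewrite /supp/=.
by apply: contraNN fa => /eqP ->; rewrite modulus0.
Qed.

(** The weight is chosen so that a test function w divided by (1 + l)^s has
    Sobolev norm of order s equal to the norm of w. *)
Lemma triform_bounded_coeff l (c s : R) xi eta : (forall a, 0 <= l a) ->
  triform_bounded l c s -> 0 <= c ->
  l2norm xi = 1%E -> l2norm eta = 1%E ->
  (\esum_(a in [set: G])
     (modulus (inner (lreg a xi) eta) ^+ 2 / (1 + l a) `^ (2 * s))%:E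
   <= (c ^+ 2)%:E)%E.
Proof.
move=> l0 tb c0 xi1 eta1.
pose z a := modulus (inner (lreg a xi) eta) / (1 + l a) `^ s.
have lp a : 0 < (1 + l a) `^ s by rewrite powR_gt0// ltr_pwDl.
suff h : (nrm z <= c%:E)%E.
  have : (nrm z ^+ 2 <= c%:E ^+ 2)%E by rewrite !expe2 lee_pmul ?nrm_ge0.
  rewrite nrm_sqr -EFin_expe; apply: le_trans; apply: le_esum => a _.
  rewrite lee_fin expr_div_n -[(_ `^ s) ^+ 2]powR_mulrn ?powR_ge0//.
  by rewrite -powRrM (mulrC s).
apply: nrm_dual => // [a|w w0 _]; first by rewrite divr_ge0 ?modulus_ge0// ltW.
pose u a := w a / (1 + l a) `^ s.
have u0 a : 0 <= u a by rewrite divr_ge0// ltW.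
have -> : nrm w = snrm l s u.
  by apply: eq_nrm => a; rewrite /u mulfVK// gt_eqF.
rewrite (eq_esum (b := fun a => (u a * modulus (inner (lreg a xi) eta))%:E)).
  apply: (le_trans (le_esum_mul u0 (modulus_inner_le xi eta))).
  rewrite -(triform_left (v := fun a => modulus (xi a))
    (w := fun a => modulus (eta a)))//.
  apply: (le_trans (tb _ _ _ _ _ _)) => //.
  by rewrite -!l2normE xi1 eta1 !mule1.
by move=> a _; rewrite /u /z mulrAC mulrA.
Qed.

Lemma coeff_ball l (M k : R) (n : nat) (z : G -> R) :
  (1 <= n)%N -> 0 <= k -> (forall a, 0 <= l a) -> (forall a, 0 <= z a) ->
  (\esum_(a in [set: G]) (z a / (1 + l a) `^ (2 * k))%:E <= M%:E)%E ->
  (\esum_(a in length_ball l n%:R) (z a)%:E <=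
    (M * 2 `^ (2 * k) * n%:R `^ (2 * k))%:E)%E.
Proof.
move=> n1 k0 l0 z0 hM.
have lp a : 0 < (1 + l a) `^ (2 * k) by rewrite powR_gt0// ltr_pwDl.
rewrite -mulrA mulrC EFinM.
have P0 : 0 <= 2 `^ (2 * k) * n%:R `^ (2 * k) :> R.
  by rewrite mulr_ge0 ?powR_ge0.
apply: (le_trans _ (lee_wpmul2l _ hM)); last by rewrite lee_fin.
rewrite -esumZl//; last by move=> a; rewrite lee_fin divr_ge0// ltW.
rewrite esum_mkcond; apply: le_esum => a _.
case: ifPn => [|_]; last first.
  by rewrite -EFinM lee_fin mulr_ge0 ?divr_ge0 ?(ltW (lp a)).
rewrite inE /length_ball/= => la; rewrite -EFinM lee_fin mulrCA ler_peMr//.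
by rewrite ler_pdivlMr// mul1r powR1D_le// mulr_ge0.
Qed.

(** Left convolution by theta; the sums converge absolutely for square summable
    theta and eta, by the Cauchy-Schwarz inequality. *)
Definition lconv theta eta : G -> R[i] :=
  fun a => csum (fun m => theta m * eta (m^-1 * a)%g).

Lemma lconv_summable theta eta a : ell2 theta -> ell2 eta ->
  cabs_summable (fun m => theta m * eta (m^-1 * a)%g).
Proof.
move=> /ell2_nrm h /ell2_nrm k; rewrite /cabs_summable.
under eq_esum do rewrite modulusM.
apply: (le_lt_trans (cauchy_schwarz (mod_ge0 theta)
  (v := fun m => modulus (eta (m^-1 * a)%g)) (fun m => modulus_ge0 _))).
rewrite (nrm_reindex (fun b => modulus (eta b)) (mulVg_bij a)).
by rewrite lte_mul_pinfty ?ge0_fin_numE ?nrm_ge0.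
Qed.

Lemma l2norm_lconv l (c s : R) theta eta : triform_bounded l c s -> 0 <= c ->
  ell2 theta -> (snrm l s (fun a => modulus (theta a)) < +oo)%E -> ell2 eta ->
  (l2norm (lconv theta eta) <=
    (c * 2)%:E * (snrm l s (fun a => modulus (theta a)) * l2norm eta))%E.
Proof.
move=> tb c0 t2 ts e2.
rewrite EFinM -muleA [X in (_ * X)%E]muleA -snrmZ//.
apply: (triform_bounded_convol tb c0 (u := fun a => 2 * modulus (theta a))
  (z := fun a => modulus (lconv theta eta a))) => //.
- by move=> a; rewrite mulr_ge0 ?modulus_ge0.
- by rewrite snrmZ// lte_mul_pinfty ?lee_fin.
- exact/ell2_nrm.
move=> b; apply: (le_trans (modulus_csum_le (lconv_summable b t2 e2))).
by apply: le_esum => a _; rewrite modulusM mulrA.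
Qed.

(** Convolution by xi is the operator; its distance to convolution by the
    truncation of xi to X is controlled by the Sobolev norm of xi outside X. *)
Lemma sobolev_infty_reduced l (c s : R) :
  triform_bounded l c s -> 0 <= c -> 0 <= s ->
  sobolev_infty l `<=` @reduced_cstar R G.
Proof.
move=> tb c0 s0 xi xiS.
have xis := sobolev_snrm (xiS s s0).
have xi2 : ell2 xi.
  by apply/ell2_nrm; rewrite -(snrm0E l); exact: sobolev_snrm (xiS 0 (lexx 0)).
have sxi_fin : snrm l s (fun a => modulus (xi a)) \is a fin_num.
  by rewrite ge0_fin_numE ?snrm_ge0.
have op_le theta (b : \bar R) : ell2 theta ->
    (snrm l s (fun a => modulus (theta a)) <= b)%E -> (b < +oo)%E ->
    (opnorm (lconv theta) <= (c * 2)%:E * b)%E.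
  move=> t2 tsb boo; apply: ge_ereal_sup => _ [eta [e2 e1] <-].
  apply: (le_trans (l2norm_lconv tb c0 t2 (le_lt_trans tsb boo) e2)).
  by rewrite e1 mule1 lee_wpmul2l// lee_fin mulr_ge0.
exists (lconv xi); last first.
  apply/funext => a.
  rewrite /lconv (csum_finite_support (finite_set1 a)); last first.
    move=> m /eqP ma; rewrite /delta; case: eqP => [E|_]; last by rewrite mulr0.
    by case/eqP: ma; rewrite -(mulVKg m a) E mulg1.
  by rewrite fset_set1 big_seq_fset1 /delta mulVg eqxx mulr1.
split; first split.
- move=> eta e2; apply/ell2_nrm; rewrite -l2normE.
  apply: (le_lt_trans (l2norm_lconv tb c0 xi2 xis e2)).
  have h : l2norm eta \is a fin_num.
    by rewrite ge0_fin_numE ?l2normE ?nrm_ge0//; exact/ell2_nrm.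
  by rewrite -ge0_fin_numE ?mule_ge0 ?lee_fin ?mulr_ge0 ?nrm_ge0// !fin_numM.
- move=> z eta eta' e2 e2'; apply/funext => a; rewrite /lconv.
  rewrite -csum_linear; try exact: lconv_summable.
  by congr csum; apply/funext => m; ring.
- apply: (le_lt_trans (op_le _ _ xi2 (lexx _) xis)).
  by rewrite lte_mul_pinfty ?lee_fin ?mulr_ge0.
move=> e e0; have e'0 : 0 < e / (c * 2 + 1).
  by rewrite divr_gt0// ltr_wpDl// mulr_ge0.
have [X finX tailX] := nrm_tail xis e'0.
pose f a := if a \in X then xi a else 0.
have ff : group_algebra f.
  apply: sub_finite_set finX => a; rewrite /supp /f /=.
  by case: ifPn => [|_]; rewrite ?inE ?eqxx.
exists f => //; pose theta a := -1 * f a + xi a.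
have thetaE a : modulus (theta a) = cut (~` X) (fun a => modulus (xi a)) a.
  rewrite /theta /f /cut in_setC; case: ifP => _ /=.
    by rewrite mulN1r addNr modulus0.
  by rewrite mulr0 add0r.
have t2 : ell2 theta.
  apply/ell2_nrm; apply: (le_lt_trans _ ((ell2_nrm xi).1 xi2)).
  by apply: le_nrm => a; rewrite modulus_ge0 thetaE cut_le.
have ts : (snrm l s (fun a => modulus (theta a)) <= (e / (c * 2 + 1))%:E)%E.
  apply: le_trans tailX; rewrite /snrm (eq_nrm (v := cut (~` X)
    (fun a => modulus (xi a) * (1 + l a) `^ s)))// => a.
  by rewrite thetaE /cut; case: ifP => // _; rewrite mul0r.
rewrite (_ : opnorm _ = opnorm (lconv theta)).
  apply: (le_lt_trans (op_le _ _ t2 ts (ltry _))).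
  rewrite -EFinM lte_fin mulrA ltr_pdivrMr; last by rewrite ltr_wpDl// mulr_ge0.
  by rewrite mulrC ltr_pM2l// ltrDl.
rewrite /opnorm; congr ereal_sup; apply: eq_imagel => eta [e2 _].
congr l2norm; apply/funext => a.
have ffX m : ~ X m -> f m = 0 by move=> Xm; rewrite /f memNset.
have f2 := group_algebra_ell2 ff.
rewrite (convol_finite _ _ finX ffX) -(csum_finite_support
  (f := fun m => f m * eta (m^-1 * a)%g) finX); last first.
  by move=> m /ffX ->; rewrite mul0r.
rewrite addrC -mulN1r -csum_linear; try exact: lconv_summable.
by congr csum; apply/funext => m; rewrite /theta; ring.
Qed.

End ConsequencesOfTheBound.

(** * The equivalence *)

Theorem proposition4p1 (R : realType) (G : groupType) (l : G -> R)
    (hl : length_function l) :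
  [<->
   (* (1) *)
   exists C D : R, forall n : nat, (1 <= n)%N ->
     forall f : G -> R[i], group_algebra f ->
       supp f `<=` length_ball l n%:R ->
       (opnorm (convol f) <= (C * n%:R `^ D)%:E * l2norm f)%E;
   (* (2) *)
   sobolev_infty l `<=` reduced_cstar;
   (* (3) *)
   exists c s : R, [/\ 0 <= c, 0 <= s &
     forall f : G -> R[i], group_algebra f ->
       (opnorm (convol f) <= c%:E * sobolev_norm l s f)%E];
   (* (4) *)
   exists C D : R, forall n : nat, (1 <= n)%N ->
     forall f g : G -> R[i], group_algebra f -> group_algebra g ->
       supp f `<=` length_ball l n%:R ->
       (l2norm (convol f g) <= (C * n%:R `^ D)%:E * l2norm f * l2norm g)%E;
   (* (5) *)
   exists C D : R, forall n : nat, (1 <= n)%N ->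
     forall f g h : G -> R[i],
       group_algebra f -> group_algebra g -> group_algebra h ->
       supp f `<=` length_ball l n%:R ->
       ((modulus (convol (convol f g) h 1%g))%:E
          <= (C * n%:R `^ D)%:E * l2norm f * l2norm g * l2norm h)%E;
   (* (6) *)
   exists M k : R, 0 <= k /\
     forall xi eta : G -> R[i], ell2 xi -> ell2 eta ->
       l2norm xi = 1%E -> l2norm eta = 1%E ->
       (\esum_(a in [set: G])
          (modulus (inner (lreg a xi) eta) ^+ 2 / (1 + l a) `^ (2 * k))%:E
        <= M%:E)%E;
   (* (7) *)
   exists C D : R, forall n : nat, (1 <= n)%N ->
     forall xi eta : G -> R[i], ell2 xi -> ell2 eta ->
       l2norm xi = 1%E -> l2norm eta = 1%E ->
       (\esum_(a in length_ball l n%:R)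
          (modulus (inner (lreg a xi) eta) ^+ 2)%:E
        <= (C * n%:R `^ (2 * D))%:E)%E
  ].
Proof.
have l0 a : 0 <= l a := length_ge0 hl a.
have triform_of_ball (C D : R) :
    0 <= C -> 0 <= D -> ball_triform_bounded l C D ->
    exists c s : R, [/\ 0 <= c, 0 <= s & triform_bounded l c s].
  move=> C0 D0 hb; exists (C * 2), (D + 2).
  by split; [rewrite mulr_ge0|rewrite addr_ge0|exact: triform_bounded_ball].
have convol3_of_convol (C D : R) : (forall n : nat, (1 <= n)%N ->
     forall f g : G -> R[i], group_algebra f -> group_algebra g ->
       supp f `<=` length_ball l n%:R ->
       (l2norm (convol f g) <= (C * n%:R `^ D)%:E * l2norm f * l2norm g)%E) ->
    forall n : nat, (1 <= n)%N ->
     forall f g h : G -> R[i],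
       group_algebra f -> group_algebra g -> group_algebra h ->
       supp f `<=` length_ball l n%:R ->
       ((modulus (convol (convol f g) h 1%g))%:E
          <= (C * n%:R `^ D)%:E * l2norm f * l2norm g * l2norm h)%E.
  by move=> h n n1 f g k ff fg fk fl; apply: convol3_bound; exact: h.
have ball_of_sobolev (c s : R) : 0 <= c -> 0 <= s ->
    (forall f : G -> R[i], group_algebra f ->
       (opnorm (convol f) <= c%:E * sobolev_norm l s f)%E) ->
   forall n : nat, (1 <= n)%N -> forall f : G -> R[i], group_algebra f ->
       supp f `<=` length_ball l n%:R ->
       (opnorm (convol f) <= (c * 2 `^ s * n%:R `^ s)%:E * l2norm f)%E.
  move=> c0 s0 h n n1 f ff fl; apply: (le_trans (h f ff)).
  exact: sobolev_ball.
tfae.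
- move=> [C [D h]].
  have /convol3_ball hb := convol3_of_convol C D (fun n n1 f g ff gg fl =>
    opnorm_bound_convol (h n n1 f ff fl) gg).
  have [c [s [c0 s0 tb]]] := triform_of_ball _ _ (normr_ge0 _) (normr_ge0 _) hb.
  exact: sobolev_infty_reduced tb c0 s0.
- move=> /(reduced_ball l0)[C [D [C0 D0 hb]]].
  have [c [s [c0 s0 tb]]] := triform_of_ball _ _ C0 D0 hb.
  by exists c, s; split=> // f; exact: triform_bounded_opnorm.
- move=> [c [s [c0 s0 h]]]; exists (c * 2 `^ s), s => n n1 f g ff gg fl.
  exact: opnorm_bound_convol (ball_of_sobolev c s c0 s0 h n n1 f ff fl) g gg.
- by move=> [C [D h]]; exists C, D; exact: convol3_of_convol.
- move=> [C [D /convol3_ball hb]].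
  have [c [s [c0 s0 tb]]] := triform_of_ball _ _ (normr_ge0 _) (normr_ge0 _) hb.
  exists (c ^+ 2), s; split=> // xi eta _ _ xi1 eta1.
  exact: triform_bounded_coeff.
- move=> [M [k [k0 h]]]; exists (M * 2 `^ (2 * k)), k.
  move=> n n1 xi eta xi2 eta2 xi1 eta1.
  apply: coeff_ball => //; last exact: h.
  by move=> a; rewrite sqr_ge0.
- move=> [C [D /coeff_triform_ball hb]].
  have [c [s [c0 s0 tb]]] := triform_of_ball _ _ (sqrtr_ge0 _) (normr_ge0 _) hb.
  exists (c * 2 `^ s), s; apply: ball_of_sobolev => // f.
  exact: triform_bounded_opnorm.
Qed.
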